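(* Let $a>0$ and let $\epsilon>0$ be sufficiently small. Suppose the Dirichlet boundary condition is imposed for the eigenvalue problem $\mathcal{D}_\epsilon f(t)=\lambda f(t)$ over the elliptic region $[(2-\sqrt3)\epsilon,\,a-(2-\sqrt3)\epsilon]$; that is, $$f((2-\sqrt3)\epsilon)=f(a-(2-\sqrt3)\epsilon)=0.$$ Then the eigenvalues are discrete and bounded from above; that is, the eigenvalues are $\infty>\lambda_0>\lambda_1>\lambda_2>\ldots$ with $\lambda_n\to-\infty$ as $n\to\infty$. If $f_n\in H_p$ is the eigenfunction corresponding to $\lambda_n$, then $f_n$ has exactly $n$ zeros in $((2-\sqrt3)\epsilon,\,a-(2-\sqrt3)\epsilon)$.
   Context: This concerns a smooth curve of length $a$ with uniform density $P(t)=1/a$, parametrized by arclength $t\in[0,a]$. The operator is $\mathcal{D}_\epsilon f(t)=A_\epsilon(t)f''(t)+B_\epsilon(t)f'(t)$ with - for $t\in[0,\epsilon]$: $A_\epsilon(t)=-\frac1{12}\big(1-4\frac t\epsilon+(\frac t\epsilon)^2\big)$, $B_\epsilon(t)=\frac{6a\epsilon^2(\epsilon-t)}{(\epsilon+t)^3}$; - for $t\in[\epsilon,a-\epsilon]$: $A_\epsilon(t)=\frac16$, $B_\epsilon(t)=0$; - for $t\in[a-\epsilon,a]$: $A_\epsilon(t)=-\frac1{12}\big(1-4\frac{a-t}\epsilon+(\frac{a-t}\epsilon)^2\big)$, $B_\epsilon(t)=-\frac{6a\epsilon^2(\epsilon+t-a)}{(\epsilon+a-t)^3}$. For $t\in[0,\epsilon]$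 let $$g(t)=\big|t-(2-\sqrt3)\epsilon\big|^{(4+2\sqrt3)a\epsilon}\,\big|t-(2+\sqrt3)\epsilon\big|^{(4-2\sqrt3)a\epsilon}\,(t+\epsilon)^{8a\epsilon}\,\exp\Big(\frac{12a\epsilon^3}{(\epsilon+t)^2}+\frac{12a\epsilon^2}{\epsilon+t}\Big),$$ and on the elliptic region let $p(t)=g(t)$ for $t\in[(2-\sqrt3)\epsilon,\epsilon]$, $p(t)=g(\epsilon)$ for $t\in[\epsilon,a-\epsilon]$, $p(t)=g(a-t)$ for $t\in[a-\epsilon,a-(2-\sqrt3)\epsilon]$. For a function $f$ put $f^{[0]}=f$ and $f^{[1]}=p f'$ (quasi-derivatives). $H_p$ is the set of functions $f$ for which $f^{[0]}$ and $f^{[1]}$ exist and are absolutely continuous on the elliptic region. Eigenfunctions are nonzero elements of $H_p$ satisfying the equation (almost everywhere) and the boundary condition. *)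

(* Defs.v *)
From mathcomp Require Import all_boot all_order all_algebra.
From mathcomp Require Import all_classical all_reals all_analysis.
Set Implicit Arguments.
Unset Strict Implicit.
Unset Printing Implicit Defensive.
Import Order.TTheory GRing.Theory Num.Theory.
Import numFieldNormedType.Exports.
Local Open Scope ring_scope.
Local Open Scope classical_set_scope.

(* A smooth curve of length a with uniform density 1/a, parametrized by        *)
(* arclength: the coefficients of the operator and the weight only involve the *)
(* numbers a and eps.                                                          *)

Definition lle_A (R : realType) (a eps t : R) : R :=
  if t <= eps then
    - (1 / 12) * (1 - 4 * (t / eps) + (t / eps) ^+ 2)
  else if t <= a - eps then 1 / 6
  else - (1 / 12) * (1 - 4 * ((a - t) / eps) + ((a - t) / eps) ^+ 2).

Definition lle_B (R : realType) (a eps t : R) : R :=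
  if t <= eps then
    6 * a * eps ^+ 2 * (eps - t) / (eps + t) ^+ 3
  else if t <= a - eps then 0
  else - (6 * a * eps ^+ 2 * (eps + t - a) / (eps + a - t) ^+ 3).

Definition lle_op (R : realType) (a eps : R) (f : R -> R) (t : R) : R :=
  lle_A a eps t * derive1 (derive1 f) t + lle_B a eps t * derive1 f t.

Definition ellL (R : realType) (eps : R) : R := (2 - Num.sqrt 3) * eps.

Definition ellR (R : realType) (a eps : R) : R := a - (2 - Num.sqrt 3) * eps.

(* Solving p'/p = B/A gives the exponent - 8 * a * eps on t + eps. The sign     *)
(* only changes p by a positive Lipschitz factor on the region, hence does not *)
(* affect the space H_p below, the only place where p occurs.                  *)
Definition weight_g (R : realType) (a eps t : R) : R :=
  `|t - (2 - Num.sqrt 3) * eps| `^ ((4 + 2 * Num.sqrt 3) * a * eps)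
  * `|t - (2 + Num.sqrt 3) * eps| `^ ((4 - 2 * Num.sqrt 3) * a * eps)
  * (t + eps) `^ (8 * a * eps)
  * expR (12 * a * eps ^+ 3 / (eps + t) ^+ 2 + 12 * a * eps ^+ 2 / (eps + t)).

Definition weight_p (R : realType) (a eps t : R) : R :=
  if t <= eps then weight_g a eps t
  else if t <= a - eps then weight_g a eps eps
  else weight_g a eps (a - t).

Definition absolutely_continuous (R : realType) (l r : R) (f : R -> R) : Prop :=
  forall e : R, 0 < e -> exists2 d : R, 0 < d &
    forall (n : nat) (u v : 'I_n -> R),
      (forall i, [/\ l <= u i, u i <= v i & v i <= r]) ->
      trivIset [set: 'I_n] (fun i => `]u i, v i[) ->
      \sum_(i < n) (v i - u i) < d ->
      \sum_(i < n) `|f (v i) - f (u i)| < e.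

(* The quasi-derivative p f' is absolutely continuous on the closed region.    *)
(* As p vanishes at the two end points, where f' may be infinite, the end point *)
(* values of p f' are those of its absolutely continuous extension h.          *)
Definition space_Hp (R : realType) (a eps : R) (f : R -> R) : Prop :=
  absolutely_continuous (ellL eps) (ellR a eps) f /\
  exists2 h : R -> R, absolutely_continuous (ellL eps) (ellR a eps) h &
    forall t, ellL eps < t < ellR a eps ->
      derivable f t 1 /\ h t = weight_p a eps t * derive1 f t.

(* Functions are total on R; only their values on the elliptic region matter.  *)
(* derive1 f is a default value where f is not derivable, so the existence of  *)
(* f'' is part of the equation.                                                *)
Definition dirichlet_eigenfunction (R : realType) (a eps lambda : R)
    (f : R -> R) : Prop :=
  [/\ space_Hp a eps f,
      exists2 t, ellL eps <= t <= ellR a eps & f t != 0,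
      {ae (@lebesgue_measure R), forall t, ellL eps <= t <= ellR a eps ->
         derivable (derive1 f) t 1 /\ lle_op a eps f t = lambda * f t}
    & f (ellL eps) = 0 /\ f (ellR a eps) = 0].

Definition dirichlet_eigenvalue (R : realType) (a eps lambda : R) : Prop :=
  exists f : R -> R, dirichlet_eigenfunction a eps lambda f.

(* Main.v *)
Require Import Defs.
From mathcomp Require Import all_boot all_order all_algebra.
From mathcomp Require Import all_classical all_reals all_analysis.
From mathcomp Require Import measurable_realfun ring lra.
Import Order.TTheory GRing.Theory Num.Theory.
Import numFieldNormedType.Exports.
Local Open Scope ring_scope.
Local Open Scope classical_set_scope.
Set Implicit Arguments.
Unset Strict Implicit.
Unset Printing Implicit Defensive.

(** Write [beta = (4 + 2 sqrt 3) a eps] and let [L], [R] be the end points of the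
    elliptic region. The equation [A f'' + B f' = lambda f] is put in divergence
    form [(p f')' = lambda (p / A) f] by the solution [p] of [p' / p = B / A],
    which partial fractions give explicitly ([edge_log_derive]). At the end points
    [p] vanishes like the distance to the power [beta] and [A] to the first order,
    so for [0 < beta < 1] both [P = 1 / p] and [W = p / A] are integrable, although
    [A] degenerates: in terms of the pair [f], [h = p f'] the problem is a regular
    Sturm-Liouville system [f' = P h], [h' = lambda W f] ([region_coefficients]).

    For such a system, eigenvalues and zeros are counted with a polar angle.
    An eigenvalue [lambda] is negative ([sl_eigenvalue_gt0]), say
    [lambda = - k ^ 2]; putting [f = rho sin th] and [h = k rho cos th] leads to
    [th' = k (P cos ^ 2 th + W sin ^ 2 th)], which is solved from [th = 0] at [L]
    by Picard iteration in the time scale [int (P + W)]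
    ([angle_solution_exists]). The angle increases in [t], and its value at
    the right end point is strictly increasing and continuous in [k], from [0]
    to infinity ([angle_right_lt], [angle_right_lipschitz], [angle_right_onto]).
    The [n]-th eigenvalue is the one for which this value is [(n + 1) pi], and
    the [n] zeros in the interior are the points where the angle is [pi], ...,
    [n pi] ([sl_oscillation]). Any two solutions vanishing at [L] are
    proportional, which gives simplicity ([sl_proportional]).

    It remains to see that the eigenfunctions in [space_Hp], for which the equation
    is required almost everywhere only, are the classical solutions of the system.
    The weight in [space_Hp] differs from [p] by a Lipschitz factor, so that
    [p f'] is absolutely continuous; its almost everywhere derivative is
    continuous, and a mean value inequality for absolutely continuous functions
    makes it a derivative everywhere ([absolutely_continuous_increment],
    [absolutely_continuous_derive], [eigenfunction_system]). Conversely, the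
    increments of a classical solution are dominated by those of the absolutely
    continuous function [int (P + W)] ([system_eigenfunction]). *)

(** * Calculus on an interval *)

Section real_calculus.
Context {R : realType}.
Implicit Types (f g : R -> R) (l r t x y z a b c d e : R).

Lemma is_deriveMf f g t a b : is_derive t 1 f a -> is_derive t 1 g b ->
  is_derive t 1 (fun x => f x * g x) (a * g t + f t * b).
Proof.
move=> df dg; have -> : a * g t + f t * b = f t *: b + g t *: a.
  by rewrite /GRing.scale /= addrC (mulrC (g t)).
exact: is_deriveM.
Qed.

Lemma is_deriveDf f g t a b : is_derive t 1 f a -> is_derive t 1 g b ->
  is_derive t 1 (fun x => f x + g x) (a + b).
Proof. by move=> df dg; exact: is_deriveD. Qed.

Lemma is_deriveBf f g t a b : is_derive t 1 f a -> is_derive t 1 g b ->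
  is_derive t 1 (fun x => f x - g x) (a - b).
Proof. by move=> df dg; exact: is_deriveB. Qed.

Lemma is_deriveZf c f t a : is_derive t 1 f a ->
  is_derive t 1 (fun x => c * f x) (c * a).
Proof. by move=> df; exact: is_deriveZ. Qed.

Lemma is_derive_compf f g t a b : is_derive (g t) 1 f a -> is_derive t 1 g b ->
  is_derive t 1 (fun x => f (g x)) (a * b).
Proof. by move=> df dg; exact: is_derive1_comp. Qed.

Lemma is_derive_continuous f t a : is_derive t 1 f a -> {for t, continuous f}.
Proof. by move=> [df _]; apply/differentiable_continuous/derivable1_diffP. Qed.

Lemma within_continuousMf f g (A : set R) : {within A, continuous f} ->
  {within A, continuous g} -> {within A, continuous (fun x => f x * g x)}.
Proof. by move=> cf cg x; apply: continuousM; [exact: cf|exact: cg]. Qed.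

Lemma within_continuousDf f g (A : set R) : {within A, continuous f} ->
  {within A, continuous g} -> {within A, continuous (fun x => f x + g x)}.
Proof. by move=> cf cg x; apply: continuousD; [exact: cf|exact: cg]. Qed.

Lemma within_continuousBf f g (A : set R) : {within A, continuous f} ->
  {within A, continuous g} -> {within A, continuous (fun x => f x - g x)}.
Proof. by move=> cf cg x; apply: continuousB; [exact: cf|exact: cg]. Qed.

Lemma within_continuous_cst c (A : set R) :
  {within A, continuous (fun _ : R => c : R)}.
Proof. by move=> x; exact: cst_continuous. Qed.

Lemma within_continuous_compf f g (A : set R) : continuous g ->
  {within A, continuous f} -> {within A, continuous (fun x => g (f x))}.
Proof.
by move=> cg cf; apply: (@within_continuous_comp _ _ _ A f g) => // x _; exact: cg.
Qed.

Lemma subset_itv_cc l r x y : l <= x -> y <= r -> `[x, y] `<=` `[l, r].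
Proof.
by move=> lx yr; apply: subset_itvScc; rewrite bnd_simp.
Qed.

Lemma widen_oo l r x y z : l <= x -> y <= r ->
  z \in `]x, y[%R -> l < z < r.
Proof.
move=> lx yr; rewrite !in_itv/= => /andP[xz zy].
by rewrite (le_lt_trans lx xz) (lt_le_trans zy yr).
Qed.

Lemma nondecreasing_derivative l r f df :
  {within `[l, r], continuous f} ->
  (forall t, l < t < r -> is_derive t 1 f (df t)) ->
  (forall t, l < t < r -> 0 <= df t) ->
  forall x y, l <= x -> x <= y -> y <= r -> f x <= f y.
Proof.
move=> cf fd df0 x y lx xy yr.
move: xy; rewrite le_eqVlt => /predU1P[->//|xy].
have [|c cxy e] := @MVT R f df x y xy _ (continuous_subspaceW (subset_itv_cc lx yr) cf).
  by move=> t /(widen_oo lx yr); exact: fd.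
by rewrite -subr_ge0 e mulr_ge0 ?subr_ge0 ?(ltW xy)//; exact/df0/(widen_oo lx yr cxy).
Qed.

Lemma increasing_derivative l r f df :
  {within `[l, r], continuous f} ->
  (forall t, l < t < r -> is_derive t 1 f (df t)) ->
  (forall t, l < t < r -> 0 < df t) ->
  forall x y, l <= x -> x < y -> y <= r -> f x < f y.
Proof.
move=> cf fd df0 x y lx xy yr.
have [|c cxy e] := @MVT R f df x y xy _ (continuous_subspaceW (subset_itv_cc lx yr) cf).
  by move=> t /(widen_oo lx yr); exact: fd.
by rewrite -subr_gt0 e mulr_gt0 ?subr_gt0//; exact/df0/(widen_oo lx yr cxy).
Qed.

Lemma constant_derivative l r f :
  {within `[l, r], continuous f} ->
  (forall t, l < t < r -> is_derive t 1 f 0) ->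
  forall x, l <= x -> x <= r -> f x = f l.
Proof.
move=> cf fd x lx xr; apply/eqP; rewrite eq_le.
have := @nondecreasing_derivative l r f (fun=> 0) cf fd (fun _ _ => lexx 0).
move=> /(_ l x (lexx _) lx xr) ->; rewrite andbT -lerN2.
apply: (@nondecreasing_derivative l r (fun t => - f t) (fun=> 0)) => //.
- by move=> z; apply: continuousN; exact: cf.
- by move=> t /fd ft; rewrite -oppr0; exact: is_deriveN.
Qed.

(** The mean value inequality in a form that allows unbounded derivatives: the
    increments of [f] are controlled by those of any [g] whose derivative
    dominates. *)
Lemma increment_bound l r f g df dg :
  {within `[l, r], continuous f} -> {within `[l, r], continuous g} ->
  (forall t, l < t < r -> is_derive t 1 f (df t)) ->
  (forall t, l < t < r -> is_derive t 1 g (dg t)) ->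
  (forall t, l < t < r -> `|df t| <= dg t) ->
  forall x y, l <= x -> x <= y -> y <= r -> `|f y - f x| <= g y - g x.
Proof.
move=> cf cg fd gd dfg x y lx xy yr; rewrite ler_norml opprB.
have h1 : g x - f x <= g y - f y.
  apply: (@nondecreasing_derivative l r (fun t => g t - f t) (fun t => dg t - df t)) => //.
  - exact: within_continuousBf.
  - by move=> t tlr; apply: is_deriveBf; [exact: gd|exact: fd].
  - by move=> t /dfg; rewrite subr_ge0; apply: le_trans; exact: ler_norm.
have h2 : g x + f x <= g y + f y.
  apply: (@nondecreasing_derivative l r (fun t => g t + f t) (fun t => dg t + df t)) => //.
  - exact: within_continuousDf.
  - by move=> t tlr; apply: is_deriveDf; [exact: gd|exact: fd].
  - by move=> t /dfg; rewrite -lerBlDr sub0r; apply: le_trans; rewrite -normrN; exact: ler_norm.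
by apply/andP; split; lra.
Qed.

Lemma is_derive_increment f z a e : is_derive z 1 f a -> 0 < e ->
  exists2 d, 0 < d & forall y, `|y - z| < d ->
    `|f y - f z - a * (y - z)| <= e * `|y - z|.
Proof.
move=> [df <-] e0.
have /cvgrPdist_le/(_ e e0) :
  (fun k => k^-1 *: ((f \o shift z) (k *: 1) - f z)) @ 0^' --> 'D_1 f z by [].
move=> [d /= d0 hd]; exists d => // y yd.
have [->|yz] := eqVneq y z; first by rewrite !subrr !mulr0 subrr normr0 mulr0.
have yz0 : y - z != 0 by rewrite subr_eq0.
have := hd (y - z); rewrite /ball_ /= sub0r normrN => /(_ yd yz0).
rewrite /GRing.scale /= mulr1 subrK => hyz.
have -> : f y - f z - 'D_1 f z * (y - z) =
    ((y - z)^-1 * (f y - f z) - 'D_1 f z) * (y - z).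
  by rewrite mulrBl mulrAC mulVf// mul1r.
by rewrite normrM ler_wpM2r// distrC.
Qed.

Lemma is_derive_of_increment f z a :
  (forall e, 0 < e -> exists2 d, 0 < d & forall y, `|y - z| < d ->
    `|f y - f z - a * (y - z)| <= e * `|y - z|) -> is_derive z 1 f a.
Proof.
move=> hf.
have cv : (fun k => k^-1 *: ((f \o shift z) (k *: 1) - f z)) @ 0^' --> a.
  apply/cvgrPdist_le => e e0; have [d d0 hd] := hf e e0.
  exists d => //= k; rewrite /ball_ /= sub0r normrN => kd k0.
  rewrite /GRing.scale /= mulr1 distrC.
  have -> : k^-1 * (f (k + z) - f z) - a = k^-1 * (f (k + z) - f z - a * k).
    by field.
  rewrite normrM normfV mulrC ler_pdivrMr ?normr_gt0//.
  by have := hd (k + z); rewrite addrK; exact.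
by split; [apply/cvg_ex; exists a|exact: (cvg_lim _ cv)].
Qed.

Lemma within_continuous_bounded l r f : l <= r -> {within `[l, r], continuous f} ->
  exists2 C, 0 < C & forall x, l <= x -> x <= r -> `|f x| <= C.
Proof.
move=> lr cf.
have cn : {within `[l, r], continuous (fun x => `|f x|)}.
  by apply: (within_continuous_compf (g := Num.norm)) => //; exact: norm_continuous.
have [c _ cmax] := EVT_max lr cn.
exists (`|f c| + 1) => [|x lx xr]; first by rewrite ltr_wpDl.
by apply: (le_trans (cmax x _)); rewrite ?in_itv/= ?lx// lerDl.
Qed.

Lemma is_derive_left_lt f z a d : is_derive z 1 f a -> 0 < a -> 0 < d ->
  exists2 x, z - d < x < z & f x < f z.
Proof.
move=> df a0 d0.
have [d1 d10 hd] := is_derive_increment df (divr_gt0 a0 (ltr0Sn _ 1)).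
pose m := Num.min d d1 / 2.
have [m0 md md1] : [/\ 0 < m, m < d & m < d1].
  by rewrite /m; case: (leP d d1) => ?; split; lra.
exists (z - m); first by apply/andP; split; lra.
have := hd (z - m); rewrite (_ : z - m - z = - m); last by ring.
rewrite normrN gtr0_norm// => /(_ md1); rewrite ler_norml => /andP[_].
by have := mulr_gt0 a0 m0; lra.
Qed.

Lemma near_oo l r t : l < t < r -> \forall y \near t, l < y < r.
Proof.
move=> tlr; have : t \in `]l, r[%R by rewrite in_itv.
by move=> /near_in_itvoo; apply: filterS => y; rewrite in_itv.
Qed.

Lemma uniform_within_continuous l r f : l <= r ->
  (forall e, 0 < e -> exists2 d, 0 < d & forall x y, l <= x -> x <= y -> y <= r ->
     y - x < d -> `|f y - f x| <= e) ->
  {within `[l, r], continuous f}.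
Proof.
move=> lr uf; pose clip x := Num.max l (Num.min r x).
apply: (@subspace_eq_continuous _ `[l, r]%classic _ (f \o clip)).
  move=> x; rewrite inE /= in_itv/= => /andP[lx xr].
  by rewrite /from_subspace/= /clip (min_idPr xr) (max_idPr lx).
apply: continuous_subspaceT => x; apply/cvgrPdist_le => e /uf[d d0 hd].
have cl y : l <= clip y <= r by rewrite /clip le_max lexx/= ge_max lr ge_min lexx.
have cn y z : y <= z -> clip y <= clip z.
  by move=> yz; rewrite /clip ge_max !le_max lexx/= le_min !ge_min lexx yz !orbT.
have ce y z : y <= z -> clip z - clip y <= z - y.
  move=> yz; have /andP[ly _] := cl y.
  have my : Num.min r y <= clip y by rewrite /clip le_max lexx orbT.
  rewrite lerBlDr {1}/clip ge_max; apply/andP; split; first lra.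
  by case: (leP r y) my => _ my; rewrite ge_min; apply/orP; [left|right]; lra.
near=> y.
have xyd : `|x - y| < d by near: y; apply: cvgr_dist_lt.
have /andP[l1 r1] := cl x; have /andP[l2 r2] := cl y.
have [xy|yx] := leP x y.
  rewrite distrC; apply: hd => //=; first exact: cn.
  by apply: le_lt_trans (ce _ _ xy) _; rewrite distrC in xyd; exact: le_lt_trans (ler_norm _) xyd.
apply: hd => //=; first exact/cn/ltW.
by apply: le_lt_trans (ce _ _ (ltW yx)) _; exact: le_lt_trans (ler_norm _) xyd.
Unshelve. all: by end_near. Qed.

Lemma derivable_within_continuous f df (A : set R) :
  (forall t, is_derive t 1 f (df t)) -> {within A, continuous f}.
Proof. by move=> fd; apply: continuous_subspaceT => t; exact: is_derive_continuous (fd t). Qed.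

Lemma geometric_bound_eq0 (x C : R) : (forall n, `|x| <= C / 2 ^+ n) -> x = 0.
Proof.
move=> hx; apply/normr0_eq0/eqP; rewrite eq_le normr_ge0 andbT.
apply/ler_addgt0Pr => e e0; rewrite add0r.
have C0 : 0 <= C by have := hx 0; rewrite expr0 divr1; exact: le_trans.
have [C00|Cn0] := eqVneq C 0.
  by apply: le_trans (ltW e0); have := hx 0; rewrite expr0 divr1 C00.
have {Cn0}C0 : 0 < C by rewrite lt_neqAle eq_sym Cn0.
have [n _ /(_ n (leqnn _)) /= hn] := near_infty_natSinv_expn_lt (PosNum (divr_gt0 e0 C0)).
apply: (le_trans (hx n)); rewrite mulrC -ler_pdivlMr// -div1r; exact: ltW.
Qed.

(** A sequence with geometric increments: [u n - 2 C / 2 ^ n] increases and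
    [u n + 2 C / 2 ^ n] decreases, so their common bound is the limit. *)
Lemma geometric_limit (u : nat -> R) (C : R) :
  (forall n, `|u n.+1 - u n| <= C / 2 ^+ n) ->
  exists L, forall n, `|L - u n| <= 2 * C / 2 ^+ n.
Proof.
move=> hu.
pose a n := u n - 2 * C / 2 ^+ n; pose b n := u n + 2 * C / 2 ^+ n.
have halve n : 2 * C / 2 ^+ n.+1 = C / 2 ^+ n.
  by rewrite exprS; field; rewrite expf_neq0.
have twice n : 2 * C / 2 ^+ n = 2 * (C / 2 ^+ n) by rewrite mulrA.
have na : {homo a : n m / (n <= m)%N >-> n <= m}.
  apply/nondecreasing_seqP => n; rewrite /a halve twice.
  by have := hu n; rewrite ler_norml => /andP[]; lra.
have nb : {homo b : n m / (n <= m)%N >-> m <= n}.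
  apply/nonincreasing_seqP => n; rewrite /b halve twice.
  by have := hu n; rewrite ler_norml => /andP[]; lra.
have C0 : 0 <= C by have := hu 0; rewrite expr0 divr1; exact: le_trans.
have ab n m : a n <= b m.
  apply: (@le_trans _ _ (a (maxn n m))); first by apply: na; exact: leq_maxl.
  apply: (@le_trans _ _ (b (maxn n m))); last by apply: nb; exact: leq_maxr.
  have : 0 <= 2 * C / 2 ^+ maxn n m by rewrite !mulr_ge0// invr_ge0 exprn_ge0.
  by rewrite /a /b; lra.
exists (sup (range a)) => n; rewrite ler_norml.
have h1 : a n <= sup (range a).
  by apply: ub_le_sup; [exists (b 0) => _ [m _ <-]|exists n].
have h2 : sup (range a) <= b n.
  by apply: ge_sup; [exists (a 0), 0|move=> _ [m _ <-]].
by move: h1 h2; rewrite /a /b => *; apply/andP; split; lra.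
Qed.

End real_calculus.

(** * Integrability and primitives *)

Section primitive.
Context {R : realType}.
Notation mu := (@lebesgue_measure R).
Implicit Types (f g : R -> R) (l r t x y k : R).

Definition integrable_cc l r g := mu.-integrable `[l, r] (EFin \o g).

Lemma measure_disjoint_itvs n (u v : 'I_n -> R) :
  (forall i, u i <= v i) -> trivIset [set: 'I_n] (fun i => `]u i, v i[) ->
  mu (\big[setU/set0]_(i < n) `]u i, v i[) = (\sum_(i < n) (v i - u i))%:E.
Proof.
move=> uv tI; rewrite measure_semi_additive_ord//; last first.
  by apply: bigsetU_measurable.
rewrite -sumEFin.
apply: eq_bigr => i _.
transitivity (mu `]u i, v i[); first by [].
rewrite lebesgue_measure_itv/= lte_fin; case: ltP => // vu.
have -> : v i = u i by apply/eqP; rewrite eq_le vu uv.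
by rewrite subrr.
Qed.

Lemma continuous_oo_measurable l r g :
  (forall t, l < t < r -> {for t, continuous g}) -> measurable_fun `[l, r] g.
Proof.
move=> cg; apply: (@measurable_fun_itv_cc _ l r false true).
apply: open_continuous_measurable_fun => //.
by move=> t; rewrite inE /= in_itv /=; exact: cg.
Qed.

(** The end points form a null set, so a bound inside the interval is enough. *)
Lemma integrable_dominated l r f g :
  (forall t, l < t < r -> {for t, continuous f}) ->
  (forall t, l < t < r -> `|f t| <= g t) ->
  integrable_cc l r g -> integrable_cc l r f.
Proof.
move=> cf fg ig.
have m2 : measurable ([set l; r] : set R) by exact: measurableU.
have mulr : mu [set l; r] = 0%E.
  apply/eqP; rewrite eq_le measure_ge0 andbT.
  apply: (le_trans (measureU2 _ _ _)) => //.
  by rewrite [X in (X + _)%E](_ : _ = 0%E) ?[X in (_ + X)%E](_ : _ = 0%E) ?adde0//;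
    exact: lebesgue_measure_set1.
have mf := continuous_oo_measurable cf.
have /measurable_EFinP mf' := mf.
have mlr : measurable (`[l, r] : set R) by [].
apply: (@negligible_integrable _ _ _ mu _ _ _ m2 mlr mf' mulr).2.
have : mu.-integrable (`[l, r] `\` [set l; r]) (EFin \o g).
  by apply: integrableS ig => //; exact: measurableD.
apply: le_integrable => //; first exact: measurableD.
  by apply/measurable_EFinP; apply: measurable_funS mf.
move=> t /= [+ /not_orP[tl tr]]; rewrite in_itv/= => /andP[lt tr'].
rewrite lee_fin (le_trans (fg _ _)) ?ler_norm//.
by rewrite !lt_neqAle lt tr' !andbT eq_sym; apply/andP; split; apply/eqP.
Qed.

Lemma integrable_ccZ l r k g : integrable_cc l r g ->
  integrable_cc l r (fun t => k * g t).
Proof. by move=> ig; have := integrableZl _ k ig; apply. Qed.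

Definition primitive l g x := \int[mu]_(t in `[l, x]) g t.

Section primitive_lemmas.
Variables (l r : R) (g : R -> R).
Hypotheses (lr : l < r) (ig : integrable_cc l r g)
  (cg : forall t, l < t < r -> {for t, continuous g}).

Lemma primitive_continuous : {within `[l, r], continuous primitive l g}.
Proof. by apply: parameterized_integral_continuous ig; exact: ltW. Qed.

Lemma primitive_left : primitive l g l = 0.
Proof. by rewrite /primitive set_itv1 Rintegral_set1. Qed.

Lemma primitive_derive t : l < t < r -> is_derive t 1 (primitive l g) (g t).
Proof.
move=> /[dup] tlr /andP[lt tr].
have [dp pe] := continuous_FTC1_closed tr ig lt (cg tlr).
by split; [exact: dp|rewrite -derive1E; exact: pe].
Qed.

(** Absolute continuity of the integral with respect to the measure, applied
    to a union of disjoint intervals. *)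
Lemma primitive_absolutely_continuous :
  absolutely_continuous l r (primitive l g).
Proof.
move=> e e0.
have iglr : mu.-integrable setT (EFin \o (g \_ `[l, r])).
  by rewrite -restrict_EFin; apply/integrable_restrict => //=; rewrite setTI.
have [d [d0 hd]] := integral_normr_continuous iglr e0.
exists d => // n u v uv tI sd.
pose A := \big[setU/set0]_(i < n) `]u i, v i[%classic.
have mA : measurable A by exact: bigsetU_measurable.
have tI' : trivIset [set` index_enum 'I_n] (fun i => `]u i, v i[%classic).
  by move=> i j _ _; apply: tI.
have muA : (mu A < d%:E)%E.
  by rewrite measure_disjoint_itvs ?lte_fin// => i; have [] := uv i.
have Alr : A `<=` `[l, r].
  rewrite /A => t; rewrite -bigcup_seq => -[i _ /=]; rewrite !in_itv/= => /andP[ut tv].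
  by have [lu _ vr] := uv i; rewrite (le_trans lu (ltW ut)) (le_trans (ltW tv) vr).
have igi (I : set R) : measurable I -> I `<=` `[l, r] -> mu.-integrable I (EFin \o g).
  by move=> mI Ilr; exact: integrableS ig.
have mgn : measurable_fun A (fun x => (`|g x|)%:E).
  apply/measurable_EFinP; apply: measurableT_comp => //.
  by have /integrableP[/measurable_EFinP] := igi _ mA Alr.
have eqg : (\int[mu]_(x in A) (`|g x|)%:E =
            \int[mu]_(x in A) (`|(g \_ `[l, r]) x|)%:E)%E.
  apply: eq_integral => t; rewrite inE => At.
  by rewrite patchE mem_set//; exact: Alr.
have := hd A mA muA; rewrite -lte_fin /Rintegral fineK; last first.
  apply: integrable_fin_num => //.
  have ig' : mu.-integrable A (EFin \o (g \_ `[l, r])) by exact: integrableS iglr.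
  by have := integrable_norm ig'.
rewrite -eqg -lte_fin -sumEFin.
apply: le_lt_trans.
rewrite /A ge0_integral_bigsetU//=; last exact: index_enum_uniq.
apply: lee_sum => i _.
have [lu uv' vr] := uv i.
have sub1 : `]u i, v i] `<=` `[l, r].
  by apply: subset_itv; rewrite bnd_simp//.
have sub2 : `[l, v i] `<=` `[l, r] by apply: subset_itv; rewrite bnd_simp.
rewrite /primitive Rintegral_itvB ?bnd_simp//; last first.
  by apply: igi.
apply: (@le_trans _ _ (\int[mu]_(t in `]u i, v i]) `|g t|)%:E).
  by rewrite lee_fin; apply: le_normr_Rintegral => //; exact: igi.
rewrite /Rintegral fineK; last first.
  apply: integrable_fin_num => //.
  by have := integrable_norm (igi `]u i, v i]%classic (ltac:(by [])) sub1).
rewrite (integral_itv_bndoo false false)//.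
have sub3 : `]u i, v i[ `<=` A.
  by rewrite /A -bigcup_seq => t ut; exists i => //=; exact: mem_index_enum.
exact: measurable_funS mgn.
Qed.

End primitive_lemmas.

(** A nonnegative function with a bounded antiderivative is integrable, even
    if it blows up at the end points: by monotone convergence over compact
    subintervals. *)
Lemma integrable_of_antiderivative l r g (F : R -> R) M : l < r ->
  (forall t, l < t < r -> {for t, continuous g}) ->
  (forall t, l < t < r -> 0 <= g t) ->
  (forall t, l < t < r -> `|F t| <= M) ->
  (forall t, l < t < r -> is_derive t 1 F (g t)) ->
  integrable_cc l r g.
Proof.
move=> lr cg g0 FM dF.
have mg := continuous_oo_measurable cg.
apply/integrableP; split; first exact/measurable_EFinP.
pose d n : R := (r - l) / 3 * n.+1%:R^-1.
have d0 n : 0 < d n by rewrite mulr_gt0// ?divr_gt0 ?subr_gt0.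
have d3 n : d n <= (r - l) / 3.
  by rewrite ler_piMr ?divr_ge0 ?subr_ge0 ?(ltW lr)// invf_le1// ler1n.
have lrd n : l + d n < r - d n by have := d3 n; have := subr_gt0 l r; rewrite lr; lra.
pose K n := `[l + d n, r - d n]%classic.
have Klr n t : K n t -> l < t < r.
  by rewrite /K /= in_itv/= => /andP[]; have := d0 n; lra.
have mgn : measurable_fun `]l, r[ (fun x => `|(EFin \o g) x|%E).
  apply/measurable_EFinP; apply: measurableT_comp => //.
  by apply: measurable_funS mg => //; exact: subset_itv_oo_cc.
rewrite (integral_itv_bndoo true false) //.
have Ue : \bigcup_n K n = `]l, r[%classic.
  apply/seteqP; split => [t [n _ /Klr]|t]; rewrite /= in_itv//= => /andP[lt tr].
  pose e := Num.min (t - l) (r - t).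
  have e0 : 0 < e by rewrite lt_min !subr_gt0 lt tr.
  have c0 : 0 < (r - l) / 3 by rewrite divr_gt0 ?subr_gt0.
  have [N _ /(_ N (leqnn _)) /= hN] := near_infty_natSinv_lt (PosNum (divr_gt0 e0 c0)).
  exists N => //; rewrite /K /= in_itv/=.
  have : d N < e by rewrite /d mulrC -ltr_pdivlMr.
  by rewrite /e lt_min => /andP[]; lra.
rewrite -Ue.
have cvgK : (\int[mu]_(x in K n) `|(EFin \o g) x|)%E @[n --> \oo] -->
    (\int[mu]_(x in \bigcup_n K n) `|(EFin \o g) x|)%E.
  apply: ge0_nondecreasing_set_cvg_integral => //.
  - move=> n m nm; apply/subsetPset/subset_itv; rewrite bnd_simp ?lerD2l ?lerN2;
    by rewrite ler_wpM2l ?divr_ge0 ?subr_ge0 ?(ltW lr)// ?lef_pV2 ?posrE// ler_nat.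
  - by move=> n; rewrite /K.
  - by move=> n; apply: measurable_funS mgn => // t /Klr; rewrite /= in_itv.
rewrite -(cvg_lim _ cvgK) //.
apply: (@le_lt_trans _ _ ((M + M)%:E)); last exact: ltry.
apply: lime_le; first by apply/cvg_ex; eexists; exact: cvgK.
apply: nearW => n.
have -> : (\int[mu]_(x in K n) `|(EFin \o g) x| = \int[mu]_(x in K n) (g x)%:E)%E.
  by apply: eq_integral => t; rewrite inE => /Klr tlr /=; rewrite ger0_norm ?g0.
rewrite (@continuous_FTC2 _ g F) //.
- rewrite -EFinB lee_fin.
  have d1 := d0 n; have d2 := lrd n.
  have h1 : `|F (l + d n)| <= M by apply: FM; apply/andP; split; lra.
  have h2 : `|F (r - d n)| <= M by apply: FM; apply/andP; split; lra.
  by move: h1 h2; rewrite !ler_norml => /andP[? ?] /andP[? ?]; lra.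
- apply: continuous_in_subspaceT => t; rewrite inE => /Klr; exact: cg.
- split.
  + move=> t; rewrite in_itv/= => tK.
    by have [] := dF t (Klr n t _) => //; rewrite /K/= in_itv/=; lra.
  + apply: cvg_at_right_filter; apply: (is_derive_continuous (dF _ _)).
    by have := d0 n; have := lrd n; lra.
  + apply: cvg_at_left_filter; apply: (is_derive_continuous (dF _ _)).
    by have := d0 n; have := lrd n; lra.
- move=> t; rewrite in_itv/= => tK; rewrite derive1E.
  by have [] := dF t (Klr n t _) => //; rewrite /K/= in_itv/=; lra.
Qed.

End primitive.

(** * Absolutely continuous functions *)

Section absolutely_continuous_mean_value.
Context {R : realType}.
Notation mu := (@lebesgue_measure R).
Implicit Types (f h : R -> R) (l r t x y e : R).

(** The intervals are listed from right to left, so that the list can be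
    extended by consing while sweeping an interval from left to right. *)
Definition chain (l x : R) (U : set R) (s : seq (R * R)) :=
  [/\ forall p, p \in s -> [/\ l <= p.1, p.1 <= p.2, p.2 <= x & `]p.1, p.2[ `<=` U]
    & pairwise (fun p q : R * R => q.2 <= p.1) s].

Lemma chain_cons l x y U s : l <= x -> x <= y -> chain l x U s ->
  `]x, y[ `<=` U -> chain l y U ((x, y) :: s).
Proof.
move=> lx xy [sU ps] xyU; split.
  move=> p; rewrite inE => /predU1P[->//|/sU[? ? px ?]].
  by split=> //; exact: le_trans px xy.
by rewrite /= ps andbT; apply/allP => q /sU[].
Qed.

Lemma chain_widen l x y U s : x <= y -> chain l x U s -> chain l y U s.
Proof.
move=> xy [sU ps]; split=> // p /sU[? ? px ?].
by split=> //; exact: le_trans px xy.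
Qed.

(** Absolute continuity in terms of lists of intervals contained in a set of
    small measure. *)
Lemma chain_variation l r h e : absolutely_continuous l r h -> 0 < e ->
  exists2 d, 0 < d & forall U, measurable U -> (mu U < d%:E)%E ->
  forall s, chain l r U s -> \sum_(p <- s) `|h p.2 - h p.1| < e.
Proof.
move=> hAC e0; have [d d0 hd] := hAC e e0.
exists d => // U mU Ud s [sU ps].
pose u (i : 'I_(size s)) := (nth (0, 0) s i).1.
pose v (i : 'I_(size s)) := (nth (0, 0) s i).2.
have uvs i := sU _ (mem_nth (0, 0) (ltn_ord i)).
have ps' (i j : 'I_(size s)) : (i < j)%N -> v j <= u i.
  by move=> ij; apply: (pairwiseP (0, 0) ps); rewrite ?inE.
have tI : trivIset [set: 'I_(size s)] (fun i => `]u i, v i[%classic).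
  move=> i j _ _ [t []]; rewrite /= !in_itv/= => /andP[uit tvi] /andP[ujt tvj].
  apply/val_inj/eqP; rewrite eqn_leq; apply/andP; split; rewrite leqNgt;
    apply/negP => /ps'.
    by rewrite leNgt (lt_trans ujt tvi).
  by rewrite leNgt (lt_trans uit tvj).
have uv i : u i <= v i by have [] := uvs i.
have sum_uv : \sum_(i < size s) (v i - u i) < d.
  rewrite -lte_fin; apply: le_lt_trans Ud.
  rewrite -(measure_disjoint_itvs uv tI); apply: le_measure; rewrite ?inE//.
    exact: bigsetU_measurable.
  by move=> t; rewrite -bigcup_seq => -[i _]; have [_ _ _] := uvs i; exact.
have := hd _ u v (fun i => _) tI sum_uv.
rewrite (big_nth (0, 0)) big_mkord; apply.
by move=> i; have [? ? ? _] := uvs i.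
Qed.

(** The mean value inequality for an absolutely continuous function: sweep
    [[l, r]] from left to right. Near a point outside the null set the
    derivative controls the increment; the other points lie in an open set of
    small measure, over which absolute continuity makes the total increment
    small. *)
Lemma absolutely_continuous_increment l r h e (N : set R) : l <= r -> 0 <= e ->
  absolutely_continuous l r h -> mu.-negligible N ->
  (forall t, l < t < r -> ~ N t -> derivable h t 1 /\ `|h^`() t| <= e) ->
  `|h r - h l| <= e * (r - l).
Proof.
move=> lr e0 hAC nN dh.
suff main e1 : 0 < e1 -> `|h r - h l| <= (e + e1) * (r - l) + e1.
  apply/ler_addgt0Pr => e2 e20.
  have rl0 : 0 < r - l + 1 by rewrite ltr_wpDl// subr_ge0.
  apply: (le_trans (main (e2 / (r - l + 1)) (divr_gt0 e20 rl0))).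
  rewrite mulrDl -addrA lerD2l -[X in _ + X]mulr1 -mulrDr divfK// gt_eqF//.
move=> e10; have [d d0 hd] := chain_variation hAC e10.
have nM : mu.-negligible (N `|` [set l] `|` [set r]).
  by apply: negligibleU; [apply: negligibleU => //|];
    apply/negligibleP => //; exact: lebesgue_measure_set1.
have [M [mM M0 NM]] := nM.
have Moo : (mu M < +oo)%E by rewrite M0 ltry.
have [U [oU MU UMd]] := lebesgue_regularity_outer mM Moo d0.
have mU : measurable U by exact: open_measurable.
have Ud : (mu U < d%:E)%E.
  have UE : (mu U <= mu M + mu (U `\` M))%E.
    by rewrite -{1}(setDUK MU); apply: measureU2 => //; exact: measurableD.
  have M0' : mu M = 0%E by exact: M0.
  by apply: le_lt_trans UMd; rewrite M0' add0e in UE.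
(* [C x] is the bound at [x], with the intervals met so far inside [U] *)
pose C x := exists2 s, chain l x U s &
  `|h x - h l| <= (e + e1) * (x - l) + \sum_(p <- s) `|h p.2 - h p.1|.
pose S := [set x | l <= x <= r /\ C x].
have Sl : S l.
  split; first by rewrite lexx.
  by exists [::]; [split|rewrite big_nil !subrr normr0 mulr0 addr0].
have hS : has_sup S by split; [exists l|exists r => x [/andP[]]].
pose z := sup S.
have lz : l <= z by exact: ub_le_sup hS.2 _ Sl.
have zr : z <= r by apply: ge_sup => [|x [/andP[]]//]; exists l.
have step : exists2 dl, 0 < dl & forall x y, S x -> z - dl < x -> x <= z ->
    z <= y -> y < z + dl -> y <= r -> S y.
  have [Uz|nUz] := pselect (U z).
    have [dl /= dl0 zU] := oU z Uz.
    exists dl => // x y [/andP[lx xr] [s cs hs]] zx xz zy yz yr.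
    have xy := le_trans xz zy.
    split; first by rewrite (le_trans lz zy).
    exists ((x, y) :: s).
      apply: chain_cons => // t; rewrite /= in_itv/= => /andP[xt ty].
      by apply: zU; rewrite /= ltr_norml; apply/andP; split; lra.
    rewrite big_cons /=.
    apply: (le_trans (ler_distD (h x) _ _)).
    have : 0 <= (e + e1) * (y - x) by rewrite mulr_ge0 ?subr_ge0// addr_ge0// ltW.
    by lra.
  have zN : ~ (N `|` [set l] `|` [set r]) z by move=> /NM /MU.
  have lzr : l < z < r.
    rewrite !lt_neqAle lz zr !andbT; apply/andP; split; apply/eqP => zE; apply: zN.
      by left; right.
    by right.
  have [|dz hz] := dh z lzr; first by move=> Nz; apply: zN; left; left.
  have [dl dl0 hdl0] := is_derive_increment (DeriveDef dz (esym (derive1E h z))) e10.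
  have hdl x : `|x - z| < dl -> `|h x - h z| <= (e + e1) * `|x - z|.
    move=> /hdl0 hx; rewrite -(subrK (derive1 h z * (x - z)) (h x - h z)).
    rewrite mulrDl addrC; apply: (le_trans (ler_normD _ _)).
    by rewrite lerD// normrM ler_wpM2r.
  exists dl => // x y [/andP[lx xr] [s cs hs]] zx xz zy yz yr.
  have xy := le_trans xz zy.
  split; first by rewrite (le_trans lz zy).
  exists s; first exact: chain_widen cs.
  have h1 := hdl x; have h2 := hdl y.
  rewrite ler0_norm ?subr_le0// in h1; rewrite ger0_norm ?subr_ge0// in h2.
  apply: (le_trans (ler_distD (h x) _ _)).
  have := ler_distD (h z) (h y) (h x); rewrite (distrC (h z)).
  have {}h1 : `|h x - h z| <= (e + e1) * - (x - z) by apply: h1; lra.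
  have {}h2 : `|h y - h z| <= (e + e1) * (y - z) by apply: h2; lra.
  by lra.
have [dl dl0 hdl] := step.
have [x Sx zx] := sup_adherent dl0 hS.
have xz : x <= z by exact: ub_le_sup hS.2 _ Sx.
pose y := Num.min r (z + dl / 2).
have Sy : S y.
  by apply: (hdl x) => //; rewrite /y ?le_min ?gt_min ?ge_min ?zr ?lexx//=; lra.
have yz : y <= z by exact: ub_le_sup hS.2 _ Sy.
have yr : y = r.
  move: yz; rewrite /y; case: (leP r (z + dl / 2)) => // _; lra.
rewrite yr in Sy; have [_ [s cs hs]] := Sy.
by apply: (le_trans hs); rewrite lerD2l; apply/ltW/(hd U).
Qed.

Lemma absolutely_continuousW l r x y h : l <= x -> y <= r ->
  absolutely_continuous l r h -> absolutely_continuous x y h.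
Proof.
move=> lx yr hAC e e0; have [d d0 hd] := hAC e e0; exists d => // n u v uv.
by apply: hd => i; have [xu ? vy] := uv i; split=> //; [exact: le_trans xu|exact: le_trans vy yr].
Qed.

Lemma absolutely_continuous_within l r h : l <= r ->
  absolutely_continuous l r h -> {within `[l, r], continuous h}.
Proof.
move=> lr hAC; apply: uniform_within_continuous => // e e0.
have [d d0 hd] := hAC e e0; exists d => // x y lx xy yr yxd.
have := hd 1%N (fun=> x) (fun=> y); rewrite !big_ord1 => /(_ _ _ yxd)/ltW; apply => //.
by move=> i j _ _ _; rewrite !ord1.
Qed.

Lemma absolutely_continuous_dominated l r f g C : 0 < C ->
  absolutely_continuous l r g ->
  (forall x y, l <= x -> x <= y -> y <= r -> `|f y - f x| <= C * `|g y - g x|) ->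
  absolutely_continuous l r f.
Proof.
move=> C0 gAC fg e e0; have [d d0 hd] := gAC (e / C) (divr_gt0 e0 C0).
exists d => // n u v uv tI sd; have := hd n u v uv tI sd.
rewrite ltr_pdivlMr// mulrC mulr_sumr; apply: le_lt_trans.
by apply: ler_sum => i _; have [? ? ?] := uv i; exact: fg.
Qed.

Lemma absolutely_continuousD l r f g : absolutely_continuous l r f ->
  absolutely_continuous l r g -> absolutely_continuous l r (fun t => f t + g t).
Proof.
move=> fAC gAC e e0; have e20 : 0 < e / 2 by rewrite divr_gt0.
have [d d0 hd] := fAC _ e20; have [d' d'0 hd'] := gAC _ e20.
exists (Num.min d d') => [|n u v uv tI]; first by rewrite lt_min d0.
rewrite lt_min => /andP[sd sd'].
have := hd n u v uv tI sd; have := hd' n u v uv tI sd'.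
set S1 := \sum_(i < n) _; set S2 := \sum_(i < n) `|f _ - _| => h1 h2.
apply: (@le_lt_trans _ _ (S2 + S1)); last by lra.
rewrite -big_split/=; apply: ler_sum => i _ /=.
by apply: le_trans (ler_normD _ _); rewrite opprD addrACA.
Qed.

Lemma absolutely_continuous_lipschitz l r f C : 0 < C ->
  (forall x y, l <= x -> x <= y -> y <= r -> `|f y - f x| <= C * (y - x)) ->
  absolutely_continuous l r f.
Proof.
move=> C0 fC e e0; exists (e / C) => [|n u v uv tI]; first by rewrite divr_gt0.
rewrite ltr_pdivlMr// mulrC mulr_sumr; apply: le_lt_trans.
by apply: ler_sum => i _; have [? ? ?] := uv i; exact: fC.
Qed.

Lemma absolutely_continuousM_lipschitz l r f q C : l <= r -> 0 < C ->
  absolutely_continuous l r f ->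
  (forall x y, l <= x -> x <= y -> y <= r -> `|q y - q x| <= C * (y - x)) ->
  absolutely_continuous l r (fun t => q t * f t).
Proof.
move=> lr C0 fAC qC.
have [B B0 fB] := within_continuous_bounded lr (absolutely_continuous_within lr fAC).
have qAC := absolutely_continuous_lipschitz C0 qC.
have [D D0 qD] := within_continuous_bounded lr (absolutely_continuous_within lr qAC).
move=> e e0.
have e1 : 0 < e / 2 / D by rewrite !divr_gt0.
have e2 : 0 < e / 2 / B by rewrite !divr_gt0.
have [d d0 hd] := fAC _ e1; have [d' d'0 hd'] := qAC _ e2.
exists (Num.min d d') => [|n u v uv tI]; first by rewrite lt_min d0.
rewrite lt_min => /andP[sd sd'].
have := hd n u v uv tI sd; rewrite ltr_pdivlMr// mulr_suml => h2.
have := hd' n u v uv tI sd'; rewrite ltr_pdivlMr// mulr_suml => h1.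
have := ltrD h1 h2; rewrite -splitr; apply: le_lt_trans.
rewrite -big_split/=; apply: ler_sum => i _ /=; have [lu uv' vr] := uv i.
have -> : q (v i) * f (v i) - q (u i) * f (u i) =
  (q (v i) - q (u i)) * f (u i) + (f (v i) - f (u i)) * q (v i) by ring.
apply: (le_trans (ler_normD _ _)); rewrite !normrM lerD// ler_wpM2l//.
  by apply: fB => //; exact: le_trans vr.
by apply: qD => //; exact: le_trans uv'.
Qed.

(** An absolutely continuous function whose derivative agrees almost everywhere
    with a continuous function is continuously differentiable. *)
Lemma absolutely_continuous_derive l r h g (N : set R) t :
  absolutely_continuous l r h -> mu.-negligible N ->
  (forall s, l < s < r -> ~ N s -> is_derive s 1 h (g s)) ->
  l < t < r -> {for t, continuous g} -> is_derive t 1 h (g t).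
Proof.
move=> hAC nN dh tlr cg; apply: is_derive_of_increment => e e0.
move/cvgrPdist_le : cg => /(_ e e0) cg.
have [d /= d0 hd] : \forall s \near t, `|g t - g s| <= e /\ l < s < r.
  by near=> s; split; near: s => //; exact: near_oo.
have hD : absolutely_continuous l r (fun s => h s + - (g t) * s).
  apply: absolutely_continuousD => //.
  apply: (@absolutely_continuous_lipschitz _ _ _ (`|g t| + 1)); first by rewrite ltr_wpDl.
  move=> x y _ xy _; rewrite -mulrBr normrM normrN.
  by rewrite (@ger0_norm _ (y - x)) ?subr_ge0// ler_wpM2r ?subr_ge0// lerDl.
have main x y : `|x - t| < d -> `|y - t| < d -> x <= y ->
    `|h y - h x - g t * (y - x)| <= e * (y - x).
  move=> xd yd xy.
  have [_ /andP[lx _]] : `|g t - g x| <= e /\ l < x < r by apply: hd; rewrite /ball_/= distrC.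
  have [_ /andP[_ yr]] : `|g t - g y| <= e /\ l < y < r by apply: hd; rewrite /ball_/= distrC.
  have := absolutely_continuous_increment xy (ltW e0)
    (absolutely_continuousW (ltW lx) (ltW yr) hD) nN.
  have -> : h y + - g t * y - (h x + - g t * x) = h y - h x - g t * (y - x) by ring.
  apply => s /andP[xs sy] Ns.
  have sd : `|t - s| < d.
    by move: xd yd; rewrite !ltr_norml => /andP[? ?] /andP[? ?]; apply/andP; split; lra.
  have [gts slr] : `|g t - g s| <= e /\ l < s < r by apply: hd.
  have ds : is_derive s 1 (fun s => h s + - g t * s) (g s + - g t * 1).
    apply: is_deriveDf; first exact: dh.
  split; first by case: ds.
  by rewrite derive1E; case: ds => _ ->; rewrite mulr1 distrC.
exists d => // y yd.
have td : `|t - t| < d by rewrite subrr normr0.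
have [ty|/ltW yt] := leP t y.
  by rewrite [X in _ <= _ * X]ger0_norm ?subr_ge0//; exact: main.
have -> : h y - h t - g t * (y - t) = - (h t - h y - g t * (t - y)) by ring.
by rewrite normrN (distrC y t) [X in _ <= _ * X]ger0_norm ?subr_ge0//; exact: main.
Unshelve. all: by end_near. Qed.

End absolutely_continuous_mean_value.

(** * The polar angle of a Sturm-Liouville system *)

(** Passing to the limit in a bound on an increment, with [x1], [x2] approximated
    by [y1], [y2]. *)
Lemma dist_limit_le (R : realType) (x1 x2 y1 y2 p q b d e : R) :
  `|x1 - y1| <= p -> `|x2 - y2| <= q -> `|y1 - y2| <= b -> q + p = d / 2 ->
  d < e -> 0 < d -> `|x1 - x2| <= b + e.
Proof.
rewrite !ler_norml => /andP[? ?] /andP[? ?] /andP[? ?] ? ? ?.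
by apply/andP; split; lra.
Qed.

(** The coefficients of the system [f' = P h], [h' = - m W f] may blow up at the
    end points as long as they are integrable. *)
Record sl_coefficients (R : realType) (l r : R) (P W : R -> R) : Prop := {
  sl_lt : l < r;
  slP_continuous : forall t, l < t < r -> {for t, continuous P};
  slW_continuous : forall t, l < t < r -> {for t, continuous W};
  slP_gt0 : forall t, l < t < r -> 0 < P t;
  slW_gt0 : forall t, l < t < r -> 0 < W t;
  slP_integrable : integrable_cc l r P;
  slW_integrable : integrable_cc l r W }.

(** Every increment along a solution is controlled by [sl_measure], so that it
    serves as the time scale in which the equations are Lipschitz. *)
Definition sl_measure (R : realType) (l : R) (P W : R -> R) :=
  primitive l (fun t => P t + W t).

(** The angle [th] of the scaled polar coordinates [f = A sin th],
    [h = k A cos th], where [m = k ^ 2], satisfies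
    [th' = k (P cos ^ 2 th + W sin ^ 2 th)]. With this scaling the right-hand side
    is positive and proportional to [k], which is what makes the angle easy to
    compare for different [k]. *)
Definition angle_field (R : realType) (P W : R -> R) (t x : R) :=
  P t * cos x ^+ 2 + W t * sin x ^+ 2.

Definition angle_solution (R : realType) (l r : R) (P W : R -> R) (k : R)
    (th : R -> R) :=
  [/\ {within `[l, r], continuous th}, th l = 0 &
  forall t, l < t < r -> is_derive t 1 th (k * angle_field P W t (th t))].

Section prufer_angle.
Context {R : realType}.
Variables (l r : R) (P W : R -> R).
Hypothesis slH : sl_coefficients l r P W.
Let lr : l < r := sl_lt slH.
Let cP := slP_continuous slH.
Let cW := slW_continuous slH.
Let P0 := slP_gt0 slH.
Let W0 := slW_gt0 slH.
Let iP := slP_integrable slH.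
Let iW := slW_integrable slH.
Implicit Types (k x y t e : R) (f g th : R -> R).

Let psi t := P t + W t.

Local Notation sigma := (sl_measure l P W).

Let cpsi t : l < t < r -> {for t, continuous psi}.
Proof. by move=> tlr; apply: continuousD; [exact: cP|exact: cW]. Qed.

Let ipsi : integrable_cc l r psi.
Proof. by apply: (integrableD _ iP iW). Qed.

Let psi0 t : l < t < r -> 0 < psi t.
Proof. by move=> tlr; rewrite addr_gt0 ?P0 ?W0. Qed.

Lemma sl_measure_continuous : {within `[l, r], continuous sigma}.
Proof. exact: primitive_continuous. Qed.

Lemma sl_measure_left : sigma l = 0.
Proof. exact: primitive_left. Qed.

Lemma sl_measure_derive t : l < t < r -> is_derive t 1 sigma (P t + W t).
Proof. exact: (@primitive_derive _ l r psi ipsi cpsi t). Qed.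

Lemma sl_measure_absolutely_continuous : absolutely_continuous l r sigma.
Proof. exact: primitive_absolutely_continuous. Qed.

Lemma sl_measure_nondecreasing x y : l <= x -> x <= y -> y <= r ->
  sigma x <= sigma y.
Proof.
apply: (nondecreasing_derivative sl_measure_continuous sl_measure_derive).
by move=> t /psi0 /ltW.
Qed.

Lemma sl_measure_ge0 t : l <= t -> t <= r -> 0 <= sigma t.
Proof. by move=> lt tr; rewrite -sl_measure_left sl_measure_nondecreasing. Qed.

Lemma sl_measure_right_gt0 : 0 < sigma r.
Proof.
rewrite -sl_measure_left.
by apply: (increasing_derivative sl_measure_continuous sl_measure_derive psi0).
Qed.

Lemma dominated_antiderivative g k :
  (forall t, l < t < r -> {for t, continuous g}) ->
  (forall t, l < t < r -> `|g t| <= k * (P t + W t)) ->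
  exists G : R -> R, [/\ {within `[l, r], continuous G}, G l = 0 &
    forall t, l < t < r -> is_derive t 1 G (g t)].
Proof.
move=> cg gk; have ig : integrable_cc l r g.
  by apply: integrable_dominated cg gk _; exact: integrable_ccZ.
exists (primitive l g); split.
- exact: primitive_continuous.
- exact: primitive_left.
- exact: primitive_derive.
Qed.

Local Notation F := (angle_field P W).

Lemma angle_fieldE t x : F t x = W t + (P t - W t) * cos x ^+ 2.
Proof. by rewrite /angle_field sin2cos2; ring. Qed.

Lemma angle_field_gt0 t x : l < t < r -> 0 < F t x.
Proof.
move=> tlr; have := cos2Dsin2 x; rewrite /angle_field.
have [s0 c0] : 0 <= sin x ^+ 2 /\ 0 <= cos x ^+ 2 by rewrite !sqr_ge0.
move=> cs; have [s1|s1] := eqVneq (sin x ^+ 2) 0.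
  by rewrite s1 mulr0 addr0 mulr_gt0 ?P0//; lra.
apply: ltr_wpDl; first by rewrite mulr_ge0// ltW ?P0.
by rewrite mulr_gt0 ?W0// lt_neqAle eq_sym s1.
Qed.

Lemma angle_field_le t x : l < t < r -> F t x <= P t + W t.
Proof.
move=> tlr; have := cos2Dsin2 x; rewrite /angle_field => cs.
by rewrite lerD// ler_piMr ?(ltW (P0 tlr)) ?(ltW (W0 tlr))//;
  have := sqr_ge0 (cos x); have := sqr_ge0 (sin x); lra.
Qed.

Lemma cos2_lipschitz x y : `|cos y ^+ 2 - cos x ^+ 2| <= `|y - x|.
Proof.
wlog xy : x y / x <= y.
  move=> H; have [/H//|/ltW/H] := leP x y.
  by rewrite distrC (distrC x).
rewrite [X in _ <= X]ger0_norm ?subr_ge0//.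
have dc (t : R) : is_derive t 1 (fun t => cos t ^+ 2) (- (2 * (cos t * sin t))).
  have -> : - (2 * (cos t * sin t)) = - sin t * cos t + cos t * - sin t by ring.
  exact: is_deriveMf (is_derive_cos t) (is_derive_cos t).
have di (t : R) : is_derive t 1 (fun t : R => t) 1 by exact: is_derive_id.
apply: (@increment_bound R x y (fun t => cos t ^+ 2) id
  (fun t => - (2 * (cos t * sin t))) (fun=> 1)) => //.
- exact: derivable_within_continuous dc.
- exact: derivable_within_continuous di.
move=> t _; rewrite normrN ler_norml; have := cos2Dsin2 t.
have := sqr_ge0 (cos t + sin t); have := sqr_ge0 (cos t - sin t).
by rewrite sqrrB sqrrD => *; apply/andP; split; lra.
Qed.

Lemma angle_field_lipschitz t x y : l < t < r ->
  `|F t y - F t x| <= (P t + W t) * `|y - x|.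
Proof.
move=> tlr; rewrite !angle_fieldE.
have -> : W t + (P t - W t) * cos y ^+ 2 - (W t + (P t - W t) * cos x ^+ 2) =
  (P t - W t) * (cos y ^+ 2 - cos x ^+ 2) by ring.
rewrite normrM ler_pM ?cos2_lipschitz// ler_norml.
by have := P0 tlr; have := W0 tlr; lra.
Qed.

Lemma angle_field_continuous th t : l < t < r -> {for t, continuous th} ->
  {for t, continuous (fun x => F x (th x))}.
Proof.
move=> tlr ct.
have cc : {for t, continuous (fun x => cos (th x))}.
  by apply: (continuous_comp ct); exact: continuous_cos.
have cs : {for t, continuous (fun x => sin (th x))}.
  by apply: (continuous_comp ct); exact: continuous_sin.
rewrite /angle_field; apply: continuousD; apply: continuousM.
- exact: cP.
- by apply: (@continuousM _ _ (fun x => cos (th x)) (fun x => cos (th x))).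
- exact: cW.
- by apply: (@continuousM _ _ (fun x => sin (th x)) (fun x => sin (th x))).
Qed.

(** Picard iteration. With distances measured in units of [exp (2 k sigma)] the
    integral operator contracts by the factor [1/2] on the whole of [[l, r]],
    and the end points need no separate treatment as [sigma] is finite there. *)
Lemma angle_solution_exists k : 0 < k -> exists th, angle_solution l r P W k th.
Proof.
move=> k0; have k0' := ltW k0.
have bound t x : l < t < r -> `|k * F t x| <= k * (P t + W t).
  move=> tlr; rewrite normrM (gtr0_norm k0) ler_wpM2l//.
  by rewrite gtr0_norm ?angle_field_gt0// angle_field_le.
have stepP th : exists T : R -> R, (forall t, l < t < r -> {for t, continuous th}) ->
    [/\ {within `[l, r], continuous T}, T l = 0 &
    forall t, l < t < r -> is_derive t 1 T (k * F t (th t))].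
  have [cth|] := pselect (forall t, l < t < r -> {for t, continuous th}); last by exists th.
  have [||T TP] := @dominated_antiderivative (fun t => k * F t (th t)) k; last by exists T.
  - move=> t tlr; apply: continuousM; first exact: cst_continuous.
    exact: angle_field_continuous (cth t tlr).
  - by move=> t tlr; exact: bound.
have [T TP] := choice stepP.
pose th n := iter n T (fun=> 0).
have cin n t : l < t < r -> {for t, continuous (th n)}.
  elim: n t => [|n ih] t tlr; first exact: cst_continuous.
  by have [_ _ d] := TP _ ih; exact: is_derive_continuous (d t tlr).
have cth n : {within `[l, r], continuous th n}.
  case: n => [|n]; first exact: within_continuous_cst.
  by have [] := TP _ (cin n).
have thl n : th n l = 0 by case: n => [|n]//; have [] := TP _ (cin n).
have dth n t : l < t < r -> is_derive t 1 (th n.+1) (k * F t (th n t)).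
  by have [_ _] := TP _ (cin n); exact.
pose E t := expR (2 * k * sigma t).
have dE t : l < t < r -> is_derive t 1 E (2 * k * (P t + W t) * E t).
  move=> tlr; rewrite mulrC; apply: (is_derive_compf (is_derive_expR _)).
  exact/is_deriveZf/sl_measure_derive.
have cE : {within `[l, r], continuous E}.
  apply: (within_continuous_compf (g := expR)); first exact: continuous_expR.
  apply: within_continuousMf sl_measure_continuous; exact: within_continuous_cst.
have El : E l = 1 by rewrite /E sl_measure_left mulr0 expR0.
have E0 t : 0 < E t by exact: expR_gt0.
(* One Picard step halves the weighted distance. *)
have contract f g df dg C : {within `[l, r], continuous f} ->
    {within `[l, r], continuous g} -> f l = 0 -> g l = 0 ->
    (forall t, l < t < r -> is_derive t 1 f (k * F t (df t))) ->
    (forall t, l < t < r -> is_derive t 1 g (k * F t (dg t))) ->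
    (forall t, l < t < r -> `|df t - dg t| <= 2 * C * E t) -> 0 <= C ->
    forall t, l <= t -> t <= r -> `|f t - g t| <= C * E t.
  move=> cf cg fl gl fd gd dfg C0 t lt tr.
  have := @increment_bound R l r (fun t => f t - g t) (fun t => C * E t)
    (fun t => k * F t (df t) - k * F t (dg t)) (fun t => C * (2 * k * (P t + W t) * E t)).
  move=> /(_ _ _ _ _ _ l t (lexx _) lt tr).
  rewrite fl gl subrr subr0 El => H; apply: (le_trans (H _ _ _ _ _)).
  - exact: within_continuousBf.
  - by apply: within_continuousMf cE; exact: within_continuous_cst.
  - by move=> s slr; apply: is_deriveBf; [exact: fd|exact: gd].
  - by move=> s slr; exact/is_deriveZf/dE.
  - move=> s slr; rewrite -mulrBr normrM (gtr0_norm k0).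
    apply: (@le_trans _ _ (k * ((P s + W s) * (2 * C * E s)))).
      rewrite ler_wpM2l//; apply: (le_trans (angle_field_lipschitz _ _ slr)).
      by rewrite ler_wpM2l ?(ltW (psi0 slr))// dfg.
    by rewrite le_eqVlt; apply/orP; left; apply/eqP; ring.
  - by rewrite mulr1 lerBlDr lerDl.
have halve n (x : R) : 2 * (x / 2 ^+ n.+1) = x / 2 ^+ n.
  by rewrite exprS; field; rewrite expf_neq0.
have p2 n : 0 <= 1 / 2 ^+ n :> R by rewrite divr_ge0// exprn_ge0.
have cauchy n t : l <= t -> t <= r -> `|th n.+1 t - th n t| <= E t / 2 ^+ n.
  elim: n t => [|n ih] t lt tr.
    rewrite expr0 divr1 /= subr0.
    have := @increment_bound R l r (th 1) (fun t => k * sigma t) _ (fun t => k * (P t + W t))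
      (cth 1) _ (dth 0) _ _ l t (lexx _) lt tr.
    rewrite thl sl_measure_left mulr0 !subr0 => H; apply: (le_trans (H _ _ _)).
    - by apply: within_continuousMf sl_measure_continuous; exact: within_continuous_cst.
    - by move=> s slr; exact/is_deriveZf/sl_measure_derive.
    - by move=> s slr; exact: bound.
    - have := expR_ge1Dx (2 * k * sigma t); rewrite -/(E t).
      have := mulr_ge0 k0' (sl_measure_ge0 lt tr); rewrite -mulrA.
      by move: (k * sigma t) (E t) => u v; lra.
  have -> : E t / 2 ^+ n.+1 = 1 / 2 ^+ n.+1 * E t by rewrite mul1r mulrC.
  apply: (contract _ _ (th n.+1) (th n)) => //.
  move=> s /andP[ls sr]; rewrite halve mul1r mulrC.
  exact: ih (ltW ls) (ltW sr).
have limP t : exists L, l <= t -> t <= r -> forall n, `|L - th n t| <= 2 * E t / 2 ^+ n.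
  have [lt|] := pselect (l <= t /\ t <= r); last by exists 0 => lt tr; exfalso; auto.
  have [|L LP] := @geometric_limit R (fun n => th n t) (E t); last by exists L.
  by move=> n; apply: cauchy; case: lt.
have [L LP] := choice limP.
(* The limit inherits the increment bound of the iterates, hence is continuous. *)
have Linc x y : l <= x -> x <= y -> y <= r -> `|L y - L x| <= k * sigma y - k * sigma x.
  move=> lx xy yr; apply/ler_addgt0Pr => e e0.
  pose C := 2 * E x + 2 * E y.
  have C0 : 0 < C by rewrite addr_gt0// mulr_gt0.
  have [n _ /(_ n (leqnn _)) /= hn] := near_infty_natSinv_expn_lt (PosNum (divr_gt0 e0 C0)).
  have hC : C / 2 ^+ n < e by move: hn; rewrite div1r ltr_pdivlMr// mulrC.
  have h1 := LP y (le_trans lx xy) yr n.+1; have h2 := LP x lx (le_trans xy yr) n.+1.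
  have h3 : `|th n.+1 y - th n.+1 x| <= k * sigma y - k * sigma x.
    apply: (@increment_bound R l r (th n.+1) (fun t => k * sigma t)
      (fun t => k * F t (th n t)) (fun t => k * (P t + W t))) => //.
    - by apply: within_continuousMf sl_measure_continuous; exact: within_continuous_cst.
    - by move=> s slr; exact/is_deriveZf/sl_measure_derive.
    - by move=> s slr; exact: bound.
  have h4 : 2 * E x / 2 ^+ n.+1 + 2 * E y / 2 ^+ n.+1 = C / 2 ^+ n / 2.
    have p0 : 2 ^+ n != 0 :> R by rewrite expf_neq0.
    by rewrite /C exprS; move: (E x) (E y) (2 ^+ n) p0 => u v p p0; field.
  by apply: dist_limit_le h1 h2 h3 h4 hC _; rewrite divr_gt0// exprn_gt0.
have cL t : l < t < r -> {for t, continuous L}.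
  move=> /[dup] tlr /andP[lt tr]; apply/cvgrPdist_le => e e0.
  have cks : {for t, continuous (fun x => k * sigma x)}.
    apply: continuousM; first exact: cst_continuous.
    exact: is_derive_continuous (sl_measure_derive tlr).
  near=> y.
  have /andP[ly yr] : l < y < r by near: y; exact: near_oo.
  have : `|k * sigma t - k * sigma y| <= e.
    by near: y; move/cvgrPdist_le : cks; exact.
  apply: le_trans; have [ty|/ltW yt] := leP t y.
    rewrite distrC (distrC (k * _)); apply: (le_trans _ (ler_norm _)).
    by apply: Linc => //; exact: ltW.
  by apply: (le_trans _ (ler_norm _)); apply: Linc => //; exact: ltW.
have [||T1 [cT T1l dT]] := @dominated_antiderivative (fun t => k * F t (L t)) k.
- move=> t tlr; apply: continuousM; first exact: cst_continuous.
  exact: angle_field_continuous (cL t tlr).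
- by move=> t tlr; exact: bound.
have TL t : l <= t -> t <= r -> T1 t = L t.
  move=> lt tr; apply/eqP; rewrite -subr_eq0; apply/eqP.
  apply: (@geometric_bound_eq0 _ _ (2 * E t)) => n.
  have h1 := LP t lt tr n.+1.
  have h2 : `|T1 t - th n.+1 t| <= 1 / 2 ^+ n * E t.
    apply: (contract _ _ L (th n)) => //.
    move=> s /andP[ls sr]; apply: (le_trans (LP s (ltW ls) (ltW sr) n)).
    by rewrite le_eqVlt; apply/orP; left; apply/eqP; ring.
  have h3 : 2 * (2 * E t / 2 ^+ n.+1) = 2 * E t / 2 ^+ n by rewrite halve.
  have h4 : 1 / 2 ^+ n * E t = E t / 2 ^+ n by rewrite mulrC mulrA mulr1.
  apply: (le_trans (ler_distD (th n.+1 t) _ _)).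
  have h5 : 2 * E t / 2 ^+ n = 2 * (E t / 2 ^+ n) by rewrite mulrA.
  rewrite (distrC (th _ t)); move: h1 h2 h3 h4 h5.
  move: (2 * E t / 2 ^+ n.+1) (2 * E t / 2 ^+ n) (E t / 2 ^+ n) (1 / 2 ^+ n * E t).
  move: `|T1 t - th n.+1 t| `|L t - th n.+1 t| => u v p q b d.
  by lra.
exists T1; split => // t /[dup] tlr /andP[lt tr].
by rewrite TL ?ltW//; exact: dT.
Unshelve. all: by end_near. Qed.

End prufer_angle.

(** * Dependence of the angle on the spectral parameter *)

Section prufer_monotonicity.
Context {R : realType}.
Variables (l r : R) (P W : R -> R).
Hypothesis slH : sl_coefficients l r P W.
Implicit Types (k x y t e : R) (f g th : R -> R).
Local Notation sigma := (sl_measure l P W).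
Local Notation F := (angle_field P W).
Let lr : l < r := sl_lt slH.
Let dsigma := sl_measure_derive slH.
Let csigma := sl_measure_continuous slH.
Let psi0 t (tlr : l < t < r) : 0 < P t + W t := addr_gt0 (slP_gt0 slH tlr) (slW_gt0 slH tlr).

(** Otherwise [f] would have a nonpositive minimum over some [[l, y]] at a point
    where its derivative is positive, yet smaller values just before. *)
Lemma stay_positive f df :
  {within `[l, r], continuous f} -> f l = 0 ->
  (forall t, l < t < r -> is_derive t 1 f (df t)) ->
  (forall t, l < t < r -> f t <= 0 -> 0 < df t) ->
  forall t, l < t < r -> 0 < f t.
Proof.
move=> cf fl fd df0 y /andP[ly yr]; rewrite ltNge; apply/negP => fy.
have [c cly cmin] := EVT_min (ltW ly) (continuous_subspaceW (subset_itv_cc (lexx l) (ltW yr)) cf).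
have {}cmin x : l <= x -> x <= y -> f c <= f x.
  by move=> lx xy; apply: cmin; rewrite in_itv/= lx xy.
move: cly; rewrite in_itv/= => /andP[lc cy].
wlog lc' : c lc cy cmin / l < c.
  (* a minimum at [l] has value [0], so that [y] is a minimum too *)
  move=> H; move: lc; rewrite le_eqVlt => /predU1P[ce|lc']; last first.
    exact: (H c (ltW lc') cy cmin lc').
  apply: (H y) => //; first exact: ltW.
  by move=> x lx xy; rewrite (le_trans fy)// -fl ce; exact: cmin.
have clr : l < c < r by rewrite lc' (le_lt_trans cy yr).
have fc : f c <= 0 by apply: le_trans fy; apply: cmin => //; exact: ltW.
have cl0 : 0 < c - l by rewrite subr_gt0.
have [x /andP[lx xc]] := is_derive_left_lt (fd c clr) (df0 c clr fc) cl0.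
rewrite ltNge cmin//; first by lra.
by rewrite (le_trans (ltW xc)).
Qed.

Let weight a := (fun t => expR (a * sigma t)).

Let dweight a t : l < t < r ->
  is_derive t 1 (weight a) (weight a t * (a * (P t + W t))).
Proof.
move=> tlr; apply: (is_derive_compf (is_derive_expR _)).
exact/is_deriveZf/dsigma.
Qed.

Let cweight a : {within `[l, r], continuous weight a}.
Proof.
apply: (within_continuous_compf (g := expR)); first exact: continuous_expR.
apply: within_continuousMf csigma; exact: within_continuous_cst.
Qed.

Let weight0 a t : 0 < weight a t. Proof. exact: expR_gt0. Qed.

Section compare.
Variables (k1 k2 : R) (th1 th2 : R -> R).
Hypotheses (k10 : 0 < k1) (k12 : k1 < k2)
  (s1 : angle_solution l r P W k1 th1) (s2 : angle_solution l r P W k2 th2).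

Let de t := th2 t - th1 t.
Let dde t := k2 * F t (th2 t) - k1 * F t (th1 t).

Let cde : {within `[l, r], continuous de}.
Proof. by case: s1 s2 => c1 _ _ [c2 _ _]; exact: within_continuousBf. Qed.

Let del : de l = 0.
Proof. by case: s1 s2 => _ l1 _ [_ l2 _]; rewrite /de l1 l2 subrr. Qed.

Let dded t : l < t < r -> is_derive t 1 de (dde t).
Proof.
by case: s1 s2 => _ _ d1 [_ _ d2] tlr; apply: is_deriveBf; [exact: d2|exact: d1].
Qed.

Let k20 : 0 < k2. Proof. exact: lt_trans k12. Qed.

Let dde_gt t : l < t < r -> - (k2 * ((P t + W t) * `|de t|)) < dde t.
Proof.
move=> tlr.
have h1 := angle_field_lipschitz slH (th1 t) (th2 t) tlr.
have h2 : 0 < (k2 - k1) * F t (th1 t).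
  by rewrite mulr_gt0 ?subr_gt0//; exact: (angle_field_gt0 slH).
have h3 : k2 * - (F t (th2 t) - F t (th1 t)) <= k2 * ((P t + W t) * `|de t|).
  rewrite ler_pM2l//; apply: le_trans h1; rewrite -normrN; exact: ler_norm.
by rewrite /dde; lra.
Qed.

Let dde_le t : l < t < r ->
  dde t <= k2 * ((P t + W t) * `|de t|) + (k2 - k1) * (P t + W t).
Proof.
move=> tlr.
have h1 := angle_field_lipschitz slH (th1 t) (th2 t) tlr.
have h2 : (k2 - k1) * F t (th1 t) <= (k2 - k1) * (P t + W t).
  by rewrite ler_pM2l ?subr_gt0//; exact: (angle_field_le slH).
have h3 : k2 * (F t (th2 t) - F t (th1 t)) <= k2 * ((P t + W t) * `|de t|).
  rewrite ler_pM2l//; apply: le_trans h1; exact: ler_norm.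
by rewrite /dde; lra.
Qed.

Let weighted a t : l < t < r -> is_derive t 1 (fun t => weight a t * de t)
  (weight a t * (a * (P t + W t) * de t + dde t)).
Proof.
move=> tlr; have := is_deriveMf (dweight a tlr) (dded tlr).
by congr is_derive; rewrite [RHS]mulrDr !mulrA.
Qed.

Let weighted_left a : weight a l * de l = 0.
Proof. by rewrite del; exact: mulr0. Qed.

Let cweighted a : {within `[l, r], continuous (fun t => weight a t * de t)}.
Proof. exact: within_continuousMf (@cweight a) cde. Qed.

(** Where the difference of the angles is not positive, it grows faster than
    the solution of a linear equation, so it is positive as soon as the
    two angles leave their common initial value. *)
Lemma angle_lt_interior t : l < t < r -> th1 t < th2 t.
Proof.
move=> tlr; rewrite -subr_gt0 -(pmulr_rgt0 _ (weight0 (- k2) t)).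
apply: (stay_positive (@cweighted (- k2)) _ (@weighted (- k2))) => //.
move=> s slr; rewrite pmulr_rle0// => des; rewrite pmulr_rgt0//.
by have := dde_gt slr; rewrite ler0_norm//; lra.
Qed.

(** Once the difference is known to be nonnegative, its product with
    [exp (k2 sigma)] increases, which gives strictness at the end point too. *)
Lemma angle_right_lt : th1 r < th2 r.
Proof.
rewrite -subr_gt0 -(pmulr_rgt0 _ (weight0 k2 r)).
rewrite -[X in X < _](weighted_left k2).
apply: (increasing_derivative (@cweighted k2) (@weighted k2)) => // s slr.
rewrite pmulr_rgt0//; have := dde_gt slr.
by rewrite ger0_norm ?subr_ge0 ?(ltW (angle_lt_interior slr))//; lra.
Qed.

(** Gronwall's inequality; it yields the continuity in [k] of the angle at [r]. *)
Lemma angle_right_lipschitz :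
  th2 r - th1 r <= (k2 - k1) * sigma r * expR (k2 * sigma r).
Proof.
have k12' : 0 < k2 - k1 by rewrite subr_gt0.
have sr0 := sl_measure_right_gt0 slH.
have gap0 : (k2 - k1) * sigma l - weight (- k2) l * de l = 0.
  by rewrite [X in _ - X](weighted_left (- k2)) sl_measure_left mulr0 subrr.
have H := @nondecreasing_derivative R l r
  (fun t => (k2 - k1) * sigma t - weight (- k2) t * de t) _ _
  (fun t tlr => is_deriveBf (is_deriveZf (k2 - k1) (dsigma tlr)) (@weighted (- k2) t tlr))
  _ l r (lexx _) (ltW lr) (lexx _).
have {}H : weight (- k2) r * de r <= (k2 - k1) * sigma r.
  rewrite -subr_ge0 -[X in X <= _]gap0.
  apply: H.
    apply: within_continuousBf (@cweighted _).
    by apply: within_continuousMf csigma; exact: within_continuous_cst.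
  move=> t tlr; rewrite subr_ge0.
  apply: (@le_trans _ _ (weight (- k2) t * ((k2 - k1) * (P t + W t)))).
    rewrite ler_pM2l//; have := dde_le tlr.
    by rewrite ger0_norm ?subr_ge0 ?(ltW (angle_lt_interior tlr))//; lra.
  rewrite ler_piMl ?mulr_ge0 ?(ltW k12') ?(ltW (psi0 tlr))//.
  rewrite /weight -expR0 ler_expR mulNr oppr_le0 mulr_ge0 ?(ltW k20)//.
  by move: tlr => /andP[lt tr]; rewrite (sl_measure_ge0 slH) ?ltW.
rewrite -ler_pdivrMr ?expR_gt0// -expRN -mulNr mulrC; exact: H.
Qed.

End compare.

Lemma angle_right_le k th : 0 < k -> angle_solution l r P W k th ->
  th r <= k * sigma r.
Proof.
move=> k0 [c1 l1 d1].
have := @increment_bound R l r th (fun t => k * sigma t) _ (fun t => k * (P t + W t)) c1 _ d1 _ _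
  l r (lexx _) (ltW lr) (lexx _).
rewrite l1 sl_measure_left mulr0 !subr0 => H.
apply: (le_trans (ler_norm _)); apply: H.
- by apply: within_continuousMf csigma; exact: within_continuous_cst.
- by move=> t tlr; exact/is_deriveZf/dsigma.
move=> t tlr; rewrite gtr0_norm ?mulr_gt0 ?(angle_field_gt0 slH)//.
by rewrite ler_pM2l// (angle_field_le slH).
Qed.

Lemma angle_increasing k th : 0 < k -> angle_solution l r P W k th ->
  forall x y, l <= x -> x < y -> y <= r -> th x < th y.
Proof.
move=> k0 [c1 l1 d1]; apply: (increasing_derivative c1 d1) => t tlr.
by rewrite mulr_gt0// (angle_field_gt0 slH).
Qed.

(** The angular speed is [k] times a weighted mean of [P] and [W], hence at least
    [k] times half their harmonic mean, [P W / (P + W)]. *)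
Lemma angle_right_ge : exists2 c, 0 < c &
  forall k th, 0 < k -> angle_solution l r P W k th -> k * c <= th r.
Proof.
pose q t := P t * W t / (P t + W t).
have q0 t : l < t < r -> 0 < q t.
  by move=> tlr; rewrite divr_gt0 ?psi0// mulr_gt0 ?(slP_gt0 slH) ?(slW_gt0 slH).
have qF t x : l < t < r -> q t <= F t x.
  move=> tlr; have p0 := slP_gt0 slH tlr; have w0 := slW_gt0 slH tlr.
  rewrite /q ler_pdivrMr ?psi0// /angle_field.
  have e : sin x ^+ 2 = 1 - cos x ^+ 2 by rewrite sin2cos2.
  have c0 := sqr_ge0 (cos x); have s0 := sqr_ge0 (sin x).
  rewrite -subr_ge0.
  have -> : (P t * cos x ^+ 2 + W t * sin x ^+ 2) * (P t + W t) - P t * W t =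
     P t ^+ 2 * cos x ^+ 2 + W t ^+ 2 * sin x ^+ 2 by rewrite e; ring.
  by rewrite addr_ge0// mulr_ge0// sqr_ge0.
have [||Q [cQ Ql dQ]] := @dominated_antiderivative _ _ _ _ _ slH q 1.
- move=> t tlr; apply: continuousM.
    by apply: continuousM; [exact: (slP_continuous slH)|exact: (slW_continuous slH)].
  apply: continuousV; first by rewrite gt_eqF ?psi0.
  by apply: continuousD; [exact: (slP_continuous slH)|exact: (slW_continuous slH)].
- move=> t tlr; rewrite gtr0_norm ?q0// mul1r.
  exact: le_trans (qF t 0 tlr) (angle_field_le slH 0 tlr).
exists (Q r).
  by rewrite -Ql; apply: (increasing_derivative cQ dQ q0).
move=> k th k0 [c1 l1 d1].
have := @nondecreasing_derivative R l r (fun t => th t - k * Q t) _ _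
  (fun t tlr => is_deriveBf (d1 t tlr) (is_deriveZf k (dQ t tlr))) _ l r (lexx _) (ltW lr) (lexx _).
rewrite l1 Ql mulr0 subrr subr_ge0; apply.
  by apply: within_continuousBf => //; apply: within_continuousMf cQ; exact: within_continuous_cst.
by move=> t tlr; rewrite -mulrBr mulr_ge0 ?(ltW k0)// subr_ge0 qF.
Qed.

(** The angle at [r] lies between [k c] and [k sigma r], so it takes every
    positive value by the intermediate value theorem. *)
Lemma angle_right_onto (th : R -> R -> R) v :
  (forall k, 0 < k -> angle_solution l r P W k (th k)) -> 0 < v ->
  exists2 k, 0 < k & th k r = v.
Proof.
move=> thP v0.
have [c c0 cP] := angle_right_ge.
have sr0 := sl_measure_right_gt0 slH.
pose a := v / sigma r; pose b := v / c.
have a0 : 0 < a by rewrite divr_gt0.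
have b0 : 0 < b by rewrite divr_gt0.
have av : th a r <= v.
  by have := angle_right_le a0 (thP a a0); rewrite /a divfK ?gt_eqF.
have bv : v <= th b r.
  by have := cP b _ b0 (thP b b0); rewrite /b divfK ?gt_eqF.
have ab : a <= b.
  rewrite leNgt; apply/negP => ba.
  have := angle_right_lt b0 ba (thP b b0) (thP a a0).
  by rewrite ltNge (le_trans av bv).
have cth : {within `[a, b], continuous (fun k => th k r)}.
  apply: uniform_within_continuous => // e e0.
  pose M := sigma r * expR (b * sigma r).
  have M0 : 0 < M by rewrite mulr_gt0// expR_gt0.
  exists (e / M) => [|x y ax xy yb]; first by rewrite divr_gt0.
  rewrite ltr_pdivlMr// => xyM.
  move: xy; rewrite le_eqVlt => /predU1P[->|xy]; first by rewrite subrr normr0 ltW.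
  have x0 := lt_le_trans a0 ax; have y0 := lt_trans x0 xy.
  have h1 := angle_right_lt x0 xy (thP x x0) (thP y y0).
  rewrite gtr0_norm ?subr_gt0//.
  apply: (le_trans (angle_right_lipschitz x0 xy (thP x x0) (thP y y0))).
  apply: le_trans (ltW xyM); rewrite -mulrA ler_wpM2l ?subr_ge0 ?(ltW xy)//.
  by rewrite /M ler_wpM2l ?(ltW sr0)// ler_expR ler_wpM2r ?(ltW sr0).
have [|k kab kv] := IVT ab cth (v := v).
  by rewrite ge_min av/= le_max bv orbT.
have k0 : 0 < k by move: kab; rewrite in_itv/= => /andP[ak _]; exact: lt_le_trans ak.
by exists k.
Qed.

End prufer_monotonicity.

(** * The oscillation theorem *)

Section oscillation.
Context {R : realType}.
Implicit Types (l r m k x t : R) (P W f h u v th : R -> R).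

Definition sl_system l r P W m f h :=
  [/\ {within `[l, r], continuous f}, {within `[l, r], continuous h},
      forall t, l < t < r -> is_derive t 1 f (P t * h t) &
      forall t, l < t < r -> is_derive t 1 h (- (m * W t * f t))].

Definition sl_dirichlet l r P W m f h :=
  [/\ sl_system l r P W m f h, f l = 0, f r = 0 &
      exists2 t, l <= t <= r & f t != 0].

Lemma sin_natmul_pi n x : sin (x + n%:R * pi) = (-1) ^+ n * sin x :> R.
Proof.
elim: n => [|n ih]; first by rewrite mul0r addr0 expr0 mul1r.
rewrite -natr1 mulrDl mul1r addrA sinDpi ih exprS; ring.
Qed.

Lemma sin_eq0_gt0 x : 0 < x -> sin x = 0 -> exists j, x = j.+1%:R * pi :> R.
Proof.
move=> x0 sx; pose n := Num.trunc (x / pi).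
have p0 : 0 < pi :> R by exact: pi_gt0.
have xp0 : 0 <= x / pi by rewrite divr_ge0 ?ltW.
have := truncn_itv xp0; rewrite -/n ler_pdivlMr// ltr_pdivrMr// -natr1 mulrDl mul1r.
move=> /andP[nx xn].
have : sin (x - n%:R * pi) = 0.
  have := sin_natmul_pi n (x - n%:R * pi); rewrite subrK sx => /esym/eqP.
  by rewrite mulf_eq0 expf_eq0 oppr_eq0 oner_eq0 andbF => /eqP.
have [xE|xne] := eqVneq x (n%:R * pi).
  by case: n {nx xn} xE => [|j]; [rewrite mul0r => xE; rewrite xE ltxx in x0|exists j].
have : 0 < sin (x - n%:R * pi).
  by apply: sin_gt0_pi; rewrite subr_gt0 lt_neqAle eq_sym xne nx ltrBlDl.
by move=> + e; rewrite e ltxx.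
Qed.

Section system.
Variables (l r : R) (P W : R -> R).
Hypothesis slH : sl_coefficients l r P W.
Let lr : l < r := sl_lt slH.

(** Polar coordinates: the angle solves a scalar equation, and the radius is the
    exponential of an integral once the angle is known. *)
Lemma angle_system k th : 0 < k -> angle_solution l r P W k th ->
  exists2 A : R -> R, (forall t, 0 < A t) &
  sl_system l r P W (k ^+ 2) (fun t => A t * sin (th t)) (fun t => k * A t * cos (th t)).
Proof.
move=> k0 [cth thl dth].
have [||rho [crho _ drho]] := @dominated_antiderivative _ _ _ _ _ slH
    (fun t => k * ((P t - W t) * (sin (th t) * cos (th t)))) k.
- move=> t tlr; have ct := is_derive_continuous (dth t tlr).
  apply: continuousM; first exact: cst_continuous.
  apply: continuousM.
    by apply: continuousB; [exact: (slP_continuous slH)|exact: (slW_continuous slH)].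
  apply: continuousM.
    by apply: (continuous_comp ct); exact: continuous_sin.
  by apply: (continuous_comp ct); exact: continuous_cos.
- move=> t tlr; rewrite normrM gtr0_norm// ler_pM2l// normrM.
  have p0 := slP_gt0 slH tlr; have w0 := slW_gt0 slH tlr.
  rewrite -[X in _ <= X]mulr1 ler_pM//.
    by rewrite ler_norml; apply/andP; split; lra.
  have := cos2Dsin2 (th t).
  have := sqr_ge0 (cos (th t) + sin (th t)); have := sqr_ge0 (cos (th t) - sin (th t)).
  by rewrite ler_norml sqrrB sqrrD => *; apply/andP; split; lra.
have csin : {within `[l, r], continuous (fun t => sin (th t))}.
  by apply: (within_continuous_compf (g := sin)) => //; exact: continuous_sin.
have ccos : {within `[l, r], continuous (fun t => cos (th t))}.
  by apply: (within_continuous_compf (g := cos)) => //; exact: continuous_cos.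
have cA : {within `[l, r], continuous (fun t => expR (rho t))}.
  by apply: (within_continuous_compf (g := expR)) => //; exact: continuous_expR.
exists (fun t => expR (rho t)) => [t|]; first exact: expR_gt0.
split.
- exact: within_continuousMf.
- by apply: within_continuousMf => //; apply: within_continuousMf cA; exact: within_continuous_cst.
- move=> t tlr.
  have := is_deriveMf (is_derive_compf (is_derive_expR _) (drho t tlr))
    (is_derive_compf (is_derive_sin _) (dth t tlr)).
  congr is_derive; rewrite /angle_field sin2cos2.
  by have := sin2cos2 (th t); rewrite expr2 => s2; ring: s2.
- move=> t tlr.
  have := is_deriveMf (is_deriveZf k (is_derive_compf (is_derive_expR _) (drho t tlr)))
    (is_derive_compf (is_derive_cos _) (dth t tlr)).
  congr is_derive; rewrite /angle_field.
  by have := sin2cos2 (th t); rewrite expr2 => s2; ring: s2.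
Qed.

(** Two solutions vanishing at [l] have a zero Wronskian, so they are
    proportional at each point; differentiating the factor, written as a
    quotient of quadratic forms, shows that it is constant. *)
Lemma sl_proportional m f h u v : sl_system l r P W m f h ->
  sl_system l r P W m u v -> f l = 0 -> u l = 0 ->
  (forall t, 0 < u t ^+ 2 + v t ^+ 2) ->
  exists c, forall t, l <= t -> t <= r -> f t = c * u t.
Proof.
move=> [cf ch df dh] [cu cv du dv] fl ul uv0.
have wr t : l <= t -> t <= r -> f t * v t = h t * u t.
  move=> lt tr; apply/eqP; rewrite -subr_eq0; apply/eqP.
  have := @constant_derivative R l r (fun t => f t * v t - h t * u t) _ _ t lt tr.
  rewrite fl ul mulr0 mul0r subrr; apply.
    by apply: within_continuousBf; exact: within_continuousMf.
  move=> s slr.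
  have := is_deriveBf (is_deriveMf (df s slr) (dv s slr)) (is_deriveMf (dh s slr) (du s slr)).
  by congr is_derive; ring.
pose N t := f t * u t + h t * v t; pose M t := u t ^+ 2 + v t ^+ 2.
have dN t : l < t < r -> is_derive t 1 N ((P t - m * W t) * (h t * u t + f t * v t)).
  move=> tlr.
  have := is_deriveDf (is_deriveMf (df t tlr) (du t tlr)) (is_deriveMf (dh t tlr) (dv t tlr)).
  by congr is_derive; ring.
have dM t : l < t < r -> is_derive t 1 M ((P t - m * W t) * (2 * u t * v t)).
  move=> tlr.
  have := is_deriveDf (is_deriveMf (du t tlr) (du t tlr)) (is_deriveMf (dv t tlr) (dv t tlr)).
  by congr is_derive; ring.
have M0 t : M t != 0 by rewrite gt_eqF ?uv0.
have cN : {within `[l, r], continuous N}.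
  by apply: within_continuousDf; exact: within_continuousMf.
have cM : {within `[l, r], continuous M}.
  by apply: within_continuousDf;
    [exact: (within_continuousMf cu cu)|exact: (within_continuousMf cv cv)].
have cMV : {within `[l, r], continuous (fun t => (M t)^-1)}.
  by move=> t; apply: continuousV; [exact: M0|exact: cM].
exists (N l / M l) => t lt tr.
have <- : N t / M t = N l / M l.
  apply: (@constant_derivative R l r (fun t => N t / M t)) => //.
    exact: within_continuousMf.
  move=> s /[dup] slr /andP[ls sr].
  have := is_deriveMf (dN s slr) (is_deriveV (M0 s) (dM s slr)).
  congr is_derive; rewrite /GRing.scale /=.
  have w := wr s (ltW ls) (ltW sr).
  have -> : f s * v s = h s * u s by [].
  rewrite -[X in X = _](mulfK (expf_neq0 2 (M0 s))).
  rewrite (_ : _ * M s ^+ 2 = 2 * (P s - m * W s) * u s ^+ 2 * (h s * u s - f s * v s)).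
    by rewrite w subrr mulr0 mul0r.
  rewrite /N /M; field: w; rewrite -/(M s); exact: M0.
apply: (mulIf (M0 t)); rewrite mulrAC divfK//.
by have w := wr t lt tr; rewrite /N /M; ring: w.
Qed.

(** If [m <= 0], the product [f h] is nondecreasing; it vanishes at both ends, so
    it is zero; since [(f ^ 2)' = 2 P f h], the function [f ^ 2] is constant. *)
Lemma sl_eigenvalue_gt0 m f h : sl_dirichlet l r P W m f h -> 0 < m.
Proof.
move=> [[cf ch df dh] fl fr [t /andP[lt tr] ft]].
rewrite ltNge; apply/negP => m0; move: ft => /eqP; apply.
have dfh s : l < s < r ->
    is_derive s 1 (fun s => f s * h s) (P s * h s ^+ 2 - m * (W s * f s ^+ 2)).
  move=> slr; have := is_deriveMf (df s slr) (dh s slr).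
  by congr is_derive; ring.
have fh0 s : l <= s -> s <= r -> f s * h s = 0.
  move=> ls sr.
  have mono := nondecreasing_derivative (within_continuousMf cf ch) dfh.
  have {}mono := mono _.
  have g0 : forall t0 : R, l < t0 < r -> 0 <= P t0 * h t0 ^+ 2 - m * (W t0 * f t0 ^+ 2).
    move=> q qlr; have p0 := slP_gt0 slH qlr; have w0 := slW_gt0 slH qlr.
    rewrite subr_ge0; apply: (@le_trans _ _ 0).
      by rewrite mulr_le0_ge0// mulr_ge0 ?sqr_ge0// ltW.
    by rewrite mulr_ge0 ?sqr_ge0// ltW.
  apply/eqP; rewrite eq_le; apply/andP; split.
    by have := mono g0 s r ls sr (lexx _); rewrite fr mul0r.
  by have := mono g0 l s (lexx _) ls sr; rewrite fl mul0r.
have f2 : f t ^+ 2 = 0.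
  have := @constant_derivative R l r (fun t => f t * f t) _ _ t lt tr.
  rewrite fl mulr0 expr2; apply; first exact: within_continuousMf.
  move=> s /[dup] slr /andP[ls sr].
  have := is_deriveMf (df s slr) (df s slr); congr is_derive.
  have w := fh0 s (ltW ls) (ltW sr).
  by ring: w.
by apply/eqP; rewrite -sqrf_eq0 f2.
Qed.

(** The solution with angle [th k] vanishes at [l], and it vanishes at [r] exactly
    when [th k r] is a positive multiple of [pi]. As [th k r] increases from [0]
    to infinity with [k], each multiple is reached once. Since the angle is
    increasing in [t], the zeros of the solution in between are the points where
    the angle passes through the smaller multiples. *)
Theorem sl_oscillation : exists kappa : nat -> R,
  [/\ forall n, 0 < kappa n,
      forall i j, (i < j)%N -> kappa i < kappa j,
      exists2 c, 0 < c & forall n, n.+1%:R * c <= kappa n,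
      forall m f h, sl_dirichlet l r P W m f h -> exists n, m = kappa n ^+ 2 &
      forall n, exists u v, [/\ sl_dirichlet l r P W (kappa n ^+ 2) u v,
        forall f h, sl_dirichlet l r P W (kappa n ^+ 2) f h ->
          exists c, forall t, l <= t -> t <= r -> f t = c * u t &
        ([set t | l < t < r /\ u t = 0] #= `I_n)%card]].
Proof.
have ex k : exists th, 0 < k -> angle_solution l r P W k th.
  have [k0|k0] := ltP 0 k; last by exists id.
  by have [th thP] := angle_solution_exists slH k0; exists th.
have [th thP] := choice ex.
have p0 : 0 < pi :> R by exact: pi_gt0.
have ek n : exists k, 0 < k /\ th k r = n.+1%:R * pi.
  have [|k k0 ke] := angle_right_onto slH thP (v := n.+1%:R * pi); last by exists k.
  by rewrite mulr_gt0.
have [kappa kP] := choice ek.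
have kappa0 n : 0 < kappa n by have [] := kP n.
have kappar n : th (kappa n) r = n.+1%:R * pi by have [] := kP n.
have thl k : 0 < k -> th k l = 0 by move=> /thP[].
have sg0 := sl_measure_right_gt0 slH.
have amp k : exists A : R -> R, 0 < k -> (forall t, 0 < A t) /\
    sl_system l r P W (k ^+ 2) (fun t => A t * sin (th k t)) (fun t => k * A t * cos (th k t)).
  have [k0|k0] := ltP 0 k; last by exists id.
  by have [A A0 As] := angle_system k0 (thP k k0); exists A.
have [A AP] := choice amp.
have prop k f h : 0 < k -> sl_system l r P W (k ^+ 2) f h -> f l = 0 ->
    exists c, forall t, l <= t -> t <= r -> f t = c * (A k t * sin (th k t)).
  move=> k0 fh fl; have [A0 As] := AP k k0.
  apply: (sl_proportional fh As fl); first by rewrite thl// sin0 mulr0.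
  move=> t; rewrite !exprMn.
  have := cos2Dsin2 (th k t); set C := cos _; set S := sin _ => e.
  have a2 : 0 < A k t ^+ 2 by rewrite exprn_gt0.
  have k2 : 0 < k ^+ 2 by rewrite exprn_gt0.
  have [s0|s0] := eqVneq (S ^+ 2) 0.
    by rewrite s0 addr0 in e; rewrite s0 mulr0 add0r e mulr1 mulr_gt0.
  apply: ltr_pwDl; first by rewrite mulr_gt0// lt_neqAle eq_sym s0 sqr_ge0.
  by apply: mulr_ge0; [apply: mulr_ge0|]; rewrite sqr_ge0.
exists kappa; split => //.
- move=> i j ij; rewrite ltNge; apply/negP; rewrite le_eqVlt => /predU1P[e|ji].
    have := kappar j; rewrite e kappar => /(mulIf (lt0r_neq0 p0))/eqP.
    by rewrite eqr_nat eqSS => /eqP ije; rewrite ije ltnn in ij.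
  have := angle_right_lt slH (kappa0 j) ji (thP _ (kappa0 j)) (thP _ (kappa0 i)).
  by rewrite !kappar ltr_pM2r// ltr_nat ltnS ltnNge ltnW.
- exists (pi / sl_measure l P W r); first by rewrite divr_gt0.
  move=> n; rewrite mulrA ler_pdivrMr// -kappar.
  exact: (angle_right_le slH) (thP _ (kappa0 n)).
- move=> m f h fD; have m0 := sl_eigenvalue_gt0 fD.
  pose k := Num.sqrt m; have k0 : 0 < k by rewrite sqrtr_gt0.
  have km : k ^+ 2 = m by rewrite sqr_sqrtr// ltW.
  have [fs fl fr [t /andP[lt tr] ft]] := fD.
  have [|c fc] := prop k f h k0 _ fl; first by rewrite km.
  have c0 : c != 0 by apply: contra_neq ft => c0; rewrite fc// c0 mul0r.
  have [A0 As] := AP k k0.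
  have : sin (th k r) = 0.
    move: fr; rewrite fc ?lexx ?(ltW lr)// => /eqP.
    by rewrite !mulf_eq0 (negPf c0) (gt_eqF (A0 r)) /= => /eqP.
  have thr0 : 0 < th k r.
    by rewrite -(thl k k0); exact: (angle_increasing slH k0 (thP k k0)).
  move=> /(sin_eq0_gt0 thr0)[j thj]; exists j; rewrite -km; congr (_ ^+ 2).
  have [kk|kk|//] := ltgtP k (kappa j).
    have := angle_right_lt slH k0 kk (thP _ k0) (thP _ (kappa0 j)).
    by rewrite thj kappar ltxx.
  have := angle_right_lt slH (kappa0 j) kk (thP _ (kappa0 j)) (thP _ k0).
  by rewrite thj kappar ltxx.
- move=> n; set k := kappa n; have k0 : 0 < k by exact: kappa0.
  have [A0 As] := AP k k0; have [cth _ _] := thP k k0.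
  have inc := angle_increasing slH k0 (thP k k0).
  have thr : th k r = n.+1%:R * pi by exact: kappar.
  have lvl x : 0 < x -> x < n.+1%:R * pi -> exists2 t, l < t < r & th k t = x.
    move=> x0 xn; have [|t] := IVT (ltW lr) cth (v := x).
      by rewrite (thl k k0) thr ge_min (ltW x0)/= le_max (ltW xn) orbT.
    rewrite in_itv/= => /andP[lt tr] tv; exists t => //.
    rewrite !lt_neqAle lt tr !andbT; apply/andP; split; apply/eqP => te.
      by move: x0; rewrite -tv -te (thl k k0) ltxx.
    by move: xn; rewrite -tv te thr ltxx.
  exists (fun t => A k t * sin (th k t)), (fun t => k * A k t * cos (th k t)).
  split.
  + split => //; first by rewrite (thl k k0) sin0 mulr0.
      by rewrite thr -[_ * pi]add0r sin_natmul_pi sin0 !mulr0.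
    have [||t tlr te] := lvl (pi / 2); first by rewrite divr_gt0.
      rewrite mulrC ltr_pM2r// (@lt_le_trans _ _ 1)// ?ler1n// invf_lt1//; lra.
    exists t; first by move: tlr => /andP[? ?]; rewrite !ltW.
    by rewrite te sin_pihalf mulr1 gt_eqF.
  + by move=> f h [fs fl _ _]; exact: (prop k f h k0 fs fl).
  + have ez j : exists t, (j < n)%N -> l < t < r /\ th k t = j.+1%:R * pi.
      have [jn|jn] := ltnP j n; last by exists l.
      have [||t tlr te] := lvl (j.+1%:R * pi); first by rewrite mulr_gt0.
        by rewrite ltr_pM2r// ltr_nat.
      by exists t.
    have [z zP] := choice ez.
    have -> : [set t | l < t < r /\ A k t * sin (th k t) = 0] = z @` `I_n.
      apply/seteqP; split => [t [/andP[lt tr] /eqP]|t [j jn <-]] /=.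
        rewrite mulf_eq0 (gt_eqF (A0 t)) /= => /eqP st.
        have tht0 : 0 < th k t by rewrite -(thl k k0); apply: inc => //; exact: ltW.
        have [j tj] := sin_eq0_gt0 tht0 st.
        have jn : (j < n)%N.
          have := inc t r (ltW lt) tr (lexx _).
          by rewrite tj thr ltr_pM2r// ltr_nat.
        exists j => //; have [/andP[lz zr] ze] := zP j jn.
        have [zt|zt|//] := ltgtP (z j) t.
          by have := inc _ _ (ltW lz) zt (ltW tr); rewrite ze tj ltxx.
        by have := inc _ _ (ltW lt) zt (ltW zr); rewrite ze tj ltxx.
      have [zlr ze] := zP j jn; split => //.
      by rewrite ze -[_ * pi]add0r sin_natmul_pi sin0 !mulr0.
    have zinj : {in `I_n &, injective z}.
      move=> i j; rewrite !inE /= => ii jn zz.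
      have [_ zi] := zP i ii; have [_ zj] := zP j jn.
      move: zj; rewrite -zz zi => /(mulIf (lt0r_neq0 p0))/eqP.
      by rewrite eqr_nat eqSS => /eqP.
    exact: inj_card_eq.
Qed.

End system.

End oscillation.

(** * The coefficients as functions of the distance to the end points *)

Section ellL_bounds.
Context {R : realType}.
Implicit Types (a eps : R).

Lemma sqrt3_sqr : Num.sqrt (3 : R) * Num.sqrt 3 = 3.
Proof. by rewrite -expr2 sqr_sqrtr. Qed.

Lemma sqrt3_gt1 : 1 < Num.sqrt (3 : R).
Proof.
by rewrite -(@ltr_pXn2r _ 2) ?nnegrE ?sqrtr_ge0// !expr2 sqrt3_sqr; lra.
Qed.

Lemma sqrt3_lt2 : Num.sqrt (3 : R) < 2.
Proof.
by rewrite -(@ltr_pXn2r _ 2) ?nnegrE ?sqrtr_ge0// !expr2 sqrt3_sqr; lra.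
Qed.

Lemma ellL_lt eps : 0 < eps -> ellL eps < eps.
Proof. by move=> e0; rewrite /ellL gtr_pMl//; have h := sqrt3_gt1; lra. Qed.

Lemma ellL_lt_ellR a eps : 0 < eps -> 2 * eps < a -> ellL eps < ellR a eps.
Proof.
move=> e0 ea; have := ellL_lt e0.
by rewrite /ellR -/(ellL eps); lra.
Qed.

End ellL_bounds.

(** Smallness of [eps]: the regions where the coefficients are not constant are
    disjoint, and the exponent of the weight at the end points of the elliptic
    region is below [1 / 2]. As [eps < 1], distances within those regions are
    below [1], where larger exponents give smaller powers. *)
Record elliptic_regime (R : realType) (a eps : R) : Prop := {
  a_gt0 : 0 < a;
  eps_gt0 : 0 < eps;
  eps_lt1 : eps < 1;
  eps2_lta : 2 * eps < a;
  beta_lt : (4 + 2 * Num.sqrt 3) * a * eps < 1 / 2 }.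

Section elliptic_region.
Context {R : realType}.
Variables (a eps : R).
Hypothesis reg : elliptic_regime a eps.
Implicit Types (s t x y : R).

Local Notation s3 := (Num.sqrt (3 : R)).
Local Notation L := (ellL eps).
Local Notation Rr := (ellR a eps).
Local Notation beta := ((4 + 2 * s3) * a * eps).
Local Notation gamma := ((4 - 2 * s3) * a * eps).
Local Notation cp := ((2 + s3) * eps).

Lemma ellL_gt0 : 0 < L.
Proof. by rewrite /ellL mulr_gt0 ?(eps_gt0 reg)// subr_gt0 sqrt3_lt2. Qed.

Lemma ellL_lt_eps : L < eps. Proof. exact/ellL_lt/(eps_gt0 reg). Qed.

Lemma eps_lt_cp : eps < cp.
Proof. by rewrite ltr_pMl ?(eps_gt0 reg)//; have h := @sqrt3_gt1 R; lra. Qed.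

Lemma ellRE : Rr = a - L. Proof. by []. Qed.

Lemma ellL_ltR : L < Rr.
Proof. exact: ellL_lt_ellR (eps_gt0 reg) (eps2_lta reg). Qed.

Lemma beta_gt0 : 0 < beta.
Proof. by rewrite !mulr_gt0 ?(a_gt0 reg) ?(eps_gt0 reg)//; have h := @sqrt3_gt1 R; lra. Qed.

(** All the coefficients are even about [a / 2] (up to a sign for [B]) and
    constant away from the ends, hence functions of the truncated distance to
    the end points of the curve. *)
Definition edge t := Num.min t (Num.min eps (a - t)).

Lemma edge_left t : t <= eps -> edge t = t.
Proof.
by move=> te; rewrite /edge (min_idPl _)// le_min te/=; move: te (eps2_lta reg); lra.
Qed.

Lemma edge_mid t : eps <= t -> t <= a - eps -> edge t = eps.
Proof.
move=> et ta; have e : Num.min eps (a - t) = eps by apply/min_idPl; move: ta; lra.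
by rewrite /edge e; apply/min_idPr.
Qed.

Lemma edge_right t : a - eps <= t -> edge t = a - t.
Proof.
move=> ta; have e : Num.min eps (a - t) = a - t by apply/min_idPr; move: ta; lra.
by rewrite /edge e; apply/min_idPr; move: ta (eps2_lta reg); lra.
Qed.

Lemma edge_bounds t : L < t < Rr -> L < edge t <= eps.
Proof.
rewrite ellRE => /andP[Lt tR].
by rewrite /edge !lt_min !ge_min lexx Lt ellL_lt_eps orbT andbT/=; move: tR; lra.
Qed.

Lemma edge_bounds_le t : L <= t <= Rr -> L <= edge t <= eps.
Proof.
rewrite ellRE => /andP[Lt tR].
by rewrite /edge !le_min !ge_min lexx Lt (ltW ellL_lt_eps) orbT andbT/=; move: tR; lra.
Qed.

Lemma edge_lipschitz x y : x <= y -> `|edge y - edge x| <= y - x.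
Proof.
move=> xy; rewrite /edge ler_norml.
case: (leP eps (a - x)) => ?; case: (leP eps (a - y)) => ?;
  case: (leP x _) => ?; case: (leP y _) => ?; apply/andP; split; lra.
Qed.

Lemma edge_continuous t : {for t, continuous edge}.
Proof.
apply/cvgrPdist_le => e e0; near=> y.
apply: (@le_trans _ _ `|t - y|); last by near: y; apply: cvgr_dist_le.
have [ty|/ltW yt] := leP t y.
  by rewrite distrC [X in _ <= X]distrC (@ger0_norm _ (y - t)) ?subr_ge0// edge_lipschitz.
by rewrite (@ger0_norm _ (t - y)) ?subr_ge0// edge_lipschitz.
Unshelve. all: by end_near. Qed.

Definition edge_A s := - (1 / 12) * (1 - 4 * (s / eps) + (s / eps) ^+ 2).
Definition edge_B s := 6 * a * eps ^+ 2 * (eps - s) / (eps + s) ^+ 3.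

Lemma lle_A_edge t : lle_A a eps t = edge_A (edge t).
Proof.
rewrite /lle_A; case: (leP t eps) => te; first by rewrite edge_left.
case: (leP t (a - eps)) => ta; last by rewrite (edge_right (ltW ta)).
by rewrite (edge_mid (ltW te) ta) /edge_A divff ?gt_eqF ?(eps_gt0 reg)//; field.
Qed.

Lemma lle_B_left t : t <= eps -> lle_B a eps t = edge_B t.
Proof. by move=> te; rewrite /lle_B te. Qed.

Lemma lle_B_mid t : eps < t -> t <= a - eps -> lle_B a eps t = 0.
Proof. by move=> te ta; rewrite /lle_B leNgt te/= ta. Qed.

Lemma lle_B_right t : a - eps < t -> lle_B a eps t = - edge_B (a - t).
Proof.
move=> ta; have te : eps < t by move: ta (eps2_lta reg); lra.
rewrite /lle_B leNgt te/= leNgt ta /edge_B; congr (- (_ * _ / _ ^+ 3)); ring.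
Qed.

Lemma weight_p_edge t : weight_p a eps t = weight_g a eps (edge t).
Proof.
rewrite /weight_p; case: (leP t eps) => te; first by rewrite edge_left.
case: (leP t (a - eps)) => ta; first by rewrite (edge_mid (ltW te) ta).
by rewrite (edge_right (ltW ta)).
Qed.

Lemma edge_A_factor s : edge_A s = (s - L) * (cp - s) / (12 * eps ^+ 2).
Proof.
have e0 : eps != 0 by rewrite gt_eqF ?(eps_gt0 reg).
by rewrite /edge_A /ellL; field: (@sqrt3_sqr R).
Qed.

Lemma edge_A_gt0 s : L < s -> s <= eps -> 0 < edge_A s.
Proof.
move=> Ls se; rewrite edge_A_factor divr_gt0 ?mulr_gt0 ?exprn_gt0 ?(eps_gt0 reg)// subr_gt0//.
exact: le_lt_trans eps_lt_cp.
Qed.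

(** The antiderivative of [B / A] found by partial fractions, with its
    singular term separated from a part that is smooth up to the end point. *)
Definition edge_reg s := gamma * ln (cp - s) - 8 * a * eps * ln (s + eps)
  + (12 * a * eps ^+ 3 / (eps + s) ^+ 2 + 12 * a * eps ^+ 2 / (eps + s)).

Definition edge_log s := beta * ln (s - L) + edge_reg s.

Definition edge_weight s := expR (edge_log s).

Let is_derive_affine (c d s : R) : is_derive s 1 (fun x => c * x + d) c.
Proof.
have := is_deriveDf (is_deriveZf c (is_derive_id s 1)) (is_derive_cst d s 1).
by congr is_derive; ring.
Qed.

Let ln_shift_derive d s : 0 < s + d ->
  is_derive s 1 (fun x => ln (x + d)) (s + d)^-1.
Proof.
move=> sd; have := @is_derive_compf R (@ln R) (fun x => x + d) s _ 1 (is_derive1_ln sd).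
rewrite mulr1; apply; have := is_derive_affine 1 d s.
by congr is_derive; apply/funext => x; ring.
Qed.

Lemma edge_reg_derive s : 0 < s -> s <= eps -> is_derive s 1 edge_reg
  (- (gamma / (cp - s)) - 8 * a * eps / (eps + s)
   - 24 * a * eps ^+ 3 / (eps + s) ^+ 3 - 12 * a * eps ^+ 2 / (eps + s) ^+ 2).
Proof.
move=> s0 se; have cs : 0 < cp - s by rewrite subr_gt0; exact: le_lt_trans eps_lt_cp.
have se0 : 0 < s + eps by rewrite addr_gt0 ?(eps_gt0 reg).
have es : eps + s != 0 by rewrite addrC gt_eqF.
have csn : cp - s != 0 by rewrite gt_eqF.
have dV : is_derive s 1 (fun x => (eps + x)^-1) (- (eps + s) ^- 2).
  have dl : is_derive s 1 (fun x => eps + x) 1.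
    by have := is_derive_affine 1 eps s; congr is_derive; apply/funext => x; ring.
  by have := is_deriveV es dl; congr is_derive; rewrite /GRing.scale /= mulr1.
have d2 : is_derive s 1 (fun x => ln (cp - x)) (- (cp - s)^-1).
  have := @is_derive_compf R (@ln R) (fun x => cp - x) s _ (-1) (is_derive1_ln cs).
  rewrite mulrN1; apply; have := is_derive_affine (-1) cp s.
  by congr is_derive; apply/funext => x; ring.
have := is_deriveDf
  (is_deriveBf (is_deriveZf gamma d2) (is_deriveZf (8 * a * eps) (ln_shift_derive se0)))
  (is_deriveDf (is_deriveZf (12 * a * eps ^+ 3) (is_deriveMf dV dV))
    (is_deriveZf (12 * a * eps ^+ 2) dV)).
congr is_derive.
  by apply/funext => x; rewrite /edge_reg -invfM.
by rewrite (addrC s eps); field; rewrite es csn.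
Qed.

Lemma edge_log_derive s : L < s -> s <= eps ->
  is_derive s 1 edge_log (edge_B s / edge_A s).
Proof.
move=> Ls se; have sL : 0 < s + - L by rewrite subr_gt0.
have s0 : 0 < s by exact: lt_trans ellL_gt0 Ls.
have cs : 0 < cp - s by rewrite subr_gt0; exact: le_lt_trans eps_lt_cp.
have := is_deriveDf (is_deriveZf beta (ln_shift_derive sL)) (edge_reg_derive s0 se).
congr is_derive.
have e0 : eps != 0 by rewrite gt_eqF ?(eps_gt0 reg).
have n1 : s - L != 0 by rewrite gt_eqF.
have n2 : cp - s != 0 by rewrite gt_eqF.
have n3 : eps + s != 0 by rewrite gt_eqF// addr_gt0 ?(eps_gt0 reg).
rewrite edge_A_factor /edge_B.
move: n1; rewrite /ellL => n1.
field: (@sqrt3_sqr R).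
by rewrite e0 n1 n2 n3.
Qed.

End elliptic_region.

(** * Reduction to a Sturm-Liouville system *)

Section sl_reduction.
Context {R : realType}.
Variables (a eps : R).
Hypothesis reg : elliptic_regime a eps.
Implicit Types (s t x y c : R).

Local Notation s3 := (Num.sqrt (3 : R)).
Local Notation L := (ellL eps).
Local Notation Rr := (ellR a eps).
Local Notation beta := ((4 + 2 * s3) * a * eps).
Local Notation gamma := ((4 - 2 * s3) * a * eps).
Local Notation cp := ((2 + s3) * eps).
Local Notation edge := (edge a eps).
Local Notation A := (lle_A a eps).
Local Notation B := (lle_B a eps).

(** The solution [p] of [p' / p = B / A], up to a constant factor. With [f' = P h],
    where [P = 1 / p], the equation [A f'' + B f' = lambda f] becomes
    [h' = lambda W f], where [W = p / A]. *)
Definition region_weight t := edge_weight a eps (edge t).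
Definition region_P t := (region_weight t)^-1.
Definition region_W t := region_weight t / A t.

Lemma region_weight_gt0 t : 0 < region_weight t.
Proof. exact: expR_gt0. Qed.

Lemma lle_A_gt0 t : L < t < Rr -> 0 < A t.
Proof.
by move=> /(edge_bounds reg)/andP[Le ee]; rewrite (lle_A_edge reg) (edge_A_gt0 reg).
Qed.

Lemma region_weight_derive t : L < t < Rr -> t <> eps -> t <> a - eps ->
  is_derive t 1 region_weight (region_weight t * (B t / A t)).
Proof.
move=> tlr te ta.
have de s : L < s -> s <= eps ->
    is_derive s 1 (edge_weight a eps) (edge_weight a eps s * (edge_B a eps s / edge_A eps s)).
  by move=> Ls se; exact: is_derive_compf (is_derive_expR _) (edge_log_derive reg Ls se).
have /andP[Le ee] := edge_bounds reg tlr.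
have dl := de _ Le ee.
have EA := lle_A_edge reg t.
have [{}te|{}te|//] := ltgtP t eps.
  have e1 : edge t = t := edge_left reg (ltW te).
  have EB := lle_B_left a (ltW te).
  apply: (@near_eq_is_derive _ _ _ (edge_weight a eps)).
    have tl : L < t < eps by move: tlr => /andP[->].
    near=> s; congr (edge_weight a eps _); apply/esym/(edge_left reg)/ltW.
    by have /andP[] : L < s < eps by near: s; exact: near_oo.
  by move: dl; rewrite -EA e1 -EB -{2}e1.
have [{}ta|{}ta|//] := ltgtP t (a - eps).
  have EB := lle_B_mid te (ltW ta); rewrite EB mul0r mulr0.
  apply: (@near_eq_is_derive _ _ _ (fun=> edge_weight a eps eps)).
  have tm : eps < t < a - eps by rewrite te.
  near=> s; have /andP[? ?] : eps < s < a - eps by near: s; exact: near_oo.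
  by congr (edge_weight a eps _); apply: esym; apply: edge_mid; exact: ltW.
have e1 : edge t = a - t := edge_right reg (ltW ta).
have EB := lle_B_right reg ta.
have dm : is_derive t 1 (fun x => a - x) (-1).
  have := is_deriveBf (is_derive_cst a t 1) (is_derive_id t 1).
  by congr is_derive; rewrite sub0r.
rewrite e1 in dl.
apply: (@near_eq_is_derive _ _ _ (fun x => edge_weight a eps (a - x))).
  have tr : a - eps < t < Rr by move: tlr => /andP[_ ->]; rewrite ta.
  near=> s; have /andP[? ?] : a - eps < s < Rr by near: s; exact: near_oo.
  by congr (edge_weight a eps _); apply: esym; apply: (edge_right reg); exact: ltW.
have := @is_derive_compf _ _ (fun x => a - x) t _ _ dl dm; congr is_derive.
by rewrite EA EB /region_weight e1 mulrN1 mulNr mulrN.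
Unshelve. all: by end_near. Qed.

Lemma edge_weight_continuous s : L < s -> s <= eps -> {for s, continuous (edge_weight a eps)}.
Proof.
move=> Ls se; have := is_derive_compf (is_derive_expR _) (edge_log_derive reg Ls se).
exact: is_derive_continuous.
Qed.

Lemma region_weight_continuous t : L < t < Rr -> {for t, continuous region_weight}.
Proof.
move=> tlr; have /andP[Le ee] := edge_bounds reg tlr.
apply: (continuous_comp (@edge_continuous R a eps t)).
exact: edge_weight_continuous.
Qed.

Lemma region_A_continuous t : {for t, continuous A}.
Proof.
have -> : A = edge_A eps \o edge by apply/funext => x; exact: (lle_A_edge reg).
apply: (continuous_comp (@edge_continuous R a eps t)).
set s := edge t.
have dl : is_derive s 1 (fun x => x / eps) eps^-1.
  have := is_deriveMf (is_derive_id s 1) (is_derive_cst eps^-1 s 1).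
  by congr is_derive; rewrite /=; ring.
have dE := is_deriveZf (- (1 / 12)) (is_deriveDf (is_deriveBf (is_derive_cst (1 : R) s 1)
  (is_deriveZf 4 dl)) (is_deriveMf dl dl)).
exact: is_derive_continuous dE.
Qed.

(** A dominating function whose antiderivative is explicit and bounded, since
    [beta > 0]. *)
Let D t := (t - L) `^ (beta - 1) + (Rr - t) `^ (beta - 1) + (eps - L) `^ (beta - 1).

Let power_derive c x : 0 < x -> is_derive x 1 (fun y => y `^ c / c) (x `^ (c - 1) * (c / c)).
Proof.
move=> x0; have := is_deriveMf (is_derive1_powR c x0) (is_derive_cst c^-1 x 1).
by congr is_derive; rewrite /=; ring.
Qed.

Let dominator_integrable : integrable_cc L Rr D.
Proof.
pose X := (Rr - L) `^ beta / beta.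
pose c := (eps - L) `^ (beta - 1).
have b0 := beta_gt0 reg.
have dD t : L < t < Rr -> is_derive t 1
    (fun t => (t - L) `^ beta / beta - (Rr - t) `^ beta / beta + c * t) (D t).
  move=> /andP[Lt tR].
  have tL : 0 < t - L by rewrite subr_gt0.
  have Rt : 0 < Rr - t by rewrite subr_gt0.
  have dl : is_derive t 1 (fun x => x - L) 1.
    have := is_deriveBf (is_derive_id t 1) (is_derive_cst L t 1).
    by congr is_derive; rewrite subr0.
  have dr : is_derive t 1 (fun x => Rr - x) (-1).
    have := is_deriveBf (is_derive_cst Rr t 1) (is_derive_id t 1).
    by congr is_derive; rewrite sub0r.
  have := is_deriveDf
    (is_deriveBf (@is_derive_compf _ _ (fun x => x - L) t _ _ (power_derive beta tL) dl)
    (@is_derive_compf _ _ (fun x => Rr - x) t _ _ (power_derive beta Rt) dr))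
    (is_deriveZf c (is_derive_id t 1)).
  congr is_derive; rewrite divff ?gt_eqF// /D -/c; ring.
apply: (@integrable_of_antiderivative _ _ _ _ _ (X + X + c * a) (ellL_ltR reg) _ _ _ dD).
- move=> t tlr; move: (tlr) => /andP[Lt tR].
  have tL : 0 < t - L by rewrite subr_gt0.
  have Rt : 0 < Rr - t by rewrite subr_gt0.
  have sl : {for t, continuous (fun x => x - L)}.
    by apply: continuousB; [exact: cvg_id|exact: cst_continuous].
  have sr : {for t, continuous (fun x => Rr - x)}.
    by apply: continuousB; [exact: cst_continuous|exact: cvg_id].
  apply: continuousD; last exact: cst_continuous.
  apply: continuousD.
    apply: (@continuous_comp _ _ _ (fun x => x - L) (fun y => y `^ (beta - 1)) t sl).
    exact: is_derive_continuous (is_derive1_powR _ tL).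
  apply: (@continuous_comp _ _ _ (fun x => Rr - x) (fun y => y `^ (beta - 1)) t sr).
  exact: is_derive_continuous (is_derive1_powR _ Rt).
- by move=> t _; rewrite /D !addr_ge0// powR_ge0.
move=> t /andP[Lt tR].
have c0 : 0 <= c by exact: powR_ge0.
have t0 : 0 < t := lt_trans (ellL_gt0 reg) Lt.
have ta : t < a by apply: (lt_trans tR); rewrite ellRE ltrBlDr ltrDl (ellL_gt0 reg).
have h1 : (t - L) `^ beta / beta <= X.
  rewrite ler_pM2r ?invr_gt0//; apply: ge0_ler_powR; rewrite ?nnegrE ?ltW//; move: Lt tR; lra.
have h2 : (Rr - t) `^ beta / beta <= X.
  rewrite ler_pM2r ?invr_gt0//; apply: ge0_ler_powR; rewrite ?nnegrE ?ltW//; move: Lt tR; lra.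
have h3 : 0 <= (t - L) `^ beta / beta by rewrite divr_ge0 ?powR_ge0// ltW.
have h4 : 0 <= (Rr - t) `^ beta / beta by rewrite divr_ge0 ?powR_ge0// ltW.
have h5 : 0 <= c * t by rewrite mulr_ge0// ltW.
have h6 : c * t <= c * a by rewrite ler_wpM2l// ltW.
move: h1 h2 h3 h4 h5 h6; rewrite -/X.
generalize ((t - L) `^ beta / beta) ((Rr - t) `^ beta / beta) (c * t) (c * a) X => u v w z X'.
by move=> *; rewrite ler_norml; apply/andP; split; lra.
Qed.

Let edge_power_le t : L < t < Rr -> (edge t - L) `^ (beta - 1) <= D t.
Proof.
move=> tlr; rewrite /D.
have h1 := powR_ge0 (t - L) (beta - 1); have h2 := powR_ge0 (Rr - t) (beta - 1).
have h3 := powR_ge0 (eps - L) (beta - 1).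
have [->|->|->] : [\/ edge t - L = t - L, edge t - L = eps - L | edge t - L = Rr - t].
- have [te|te] := leP t eps; first by rewrite (edge_left reg)//; apply: Or31.
  have [ta|ta] := leP t (a - eps); first by rewrite edge_mid ?(ltW te)//; apply: Or32.
  by rewrite (edge_right reg) ?(ltW ta)// addrAC; apply: Or33.
- by rewrite -[X in X <= _]addr0 -[X in _ <= X]addrA lerD2l addr_ge0.
- by rewrite lerDr addr_ge0.
- by rewrite -[X in X <= _]addr0 lerD// lerDr.
Qed.

(** Let [x] be the distance to an end point. There [p] behaves like [x ^ beta] and
    [A] vanishes to the first order, so [P] and [W] behave like [x ^ - beta] and
    [x ^ (beta - 1)]; since [beta < 1 / 2], the latter dominates both. *)
Lemma region_coefficients : sl_coefficients L Rr region_P region_W.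
Proof.
have Leps := ltW (ellL_lt_eps reg).
have creg : {within `[L, eps], continuous (edge_reg a eps)}.
  apply: continuous_in_subspaceT => s; rewrite inE /= in_itv/= => /andP[Ls se].
  exact: is_derive_continuous (edge_reg_derive reg (lt_le_trans (ellL_gt0 reg) Ls) se).
have [K K0 hK] := within_continuous_bounded Leps creg.
have ew s : L < s -> edge_weight a eps s = (s - L) `^ beta * expR (edge_reg a eps s).
  move=> Ls; rewrite /edge_weight /edge_log expRD /powR gt_eqF ?subr_gt0//.
have x01 s : L < s -> s <= eps -> 0 < s - L <= 1.
  move=> Ls se; rewrite subr_gt0 Ls/=.
  have := ellL_gt0 reg; have := eps_lt1 reg; move: se; lra.
have b0 := beta_gt0 reg; have b1 := beta_lt reg.
have cP t : L < t < Rr -> {for t, continuous region_P}.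
  move=> tlr; apply: continuousV; first by rewrite gt_eqF// region_weight_gt0.
  exact: region_weight_continuous.
have cW t : L < t < Rr -> {for t, continuous region_W}.
  move=> tlr; apply: continuousM; first exact: region_weight_continuous.
  apply: continuousV; first by rewrite gt_eqF// lle_A_gt0.
  exact: region_A_continuous.
split => //.
- exact: ellL_ltR.
- by move=> t _; rewrite invr_gt0 region_weight_gt0.
- by move=> t tlr; rewrite divr_gt0 ?region_weight_gt0 ?lle_A_gt0.
- apply: (integrable_dominated cP _ (integrable_ccZ (expR K) dominator_integrable)) => t tlr.
  have /andP[Le ee] := edge_bounds reg tlr.
  rewrite gtr0_norm ?invr_gt0 ?region_weight_gt0//.
  apply: (@le_trans _ _ (expR K * (edge t - L) `^ (beta - 1))); last first.
    by rewrite ler_wpM2l ?expR_ge0// edge_power_le.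
  rewrite /region_P /region_weight ew// invfM -powRN -expRN mulrC.
  apply: ler_pM; rewrite ?expR_ge0 ?powR_ge0//.
    rewrite ler_expR; have := hK _ (ltW Le) ee; rewrite ler_norml => /andP[+ _].
    by rewrite lerNl.
  apply: ger_powR; first exact: x01.
  by move: b1; lra.
- pose C := 12 * eps ^+ 2 / (cp - eps).
  have cpe : 0 < cp - eps by rewrite subr_gt0 (eps_lt_cp reg).
  apply: (integrable_dominated cW _ (integrable_ccZ (expR K * C) dominator_integrable)) => t tlr.
  have /andP[Le ee] := edge_bounds reg tlr.
  rewrite gtr0_norm ?divr_gt0 ?region_weight_gt0 ?lle_A_gt0//.
  have C0 : 0 < C by rewrite divr_gt0// mulr_gt0// exprn_gt0 ?(eps_gt0 reg).
  apply: (@le_trans _ _ (expR K * C * (edge t - L) `^ (beta - 1))); last first.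
    have K0' : 0 <= expR K * C by rewrite mulr_ge0 ?expR_ge0// ltW.
    exact: ler_wpM2l K0' _ _ (edge_power_le tlr).
  rewrite /region_W /region_weight (lle_A_edge reg) (edge_A_factor reg) ew//.
  set s := edge t in Le ee *.
  have s0 : 0 < s - L by rewrite subr_gt0.
  have cs : 0 < cp - s by rewrite subr_gt0; exact: le_lt_trans (eps_lt_cp reg).
  have e0 : 0 < 12 * eps ^+ 2 by rewrite mulr_gt0// exprn_gt0 ?(eps_gt0 reg).
  rewrite -(mulr_powRB1 (ltW s0) b0).
  set p := _ `^ _; set q := expR (edge_reg _ _ _).
  rewrite [X in X <= _](_ : _ = q * (12 * eps ^+ 2 / (cp - s)) * p); last first.
    by field; rewrite !gt_eqF ?(eps_gt0 reg).
  rewrite ler_wpM2r ?powR_ge0//.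
  apply: ler_pM; rewrite ?expR_ge0 ?divr_ge0 ?(ltW e0) ?(ltW cs)//.
    by rewrite ler_expR; have := hK _ (ltW Le) ee; rewrite ler_norml => /andP[].
  by rewrite /C ler_pM2l// lef_pV2 ?posrE// lerD2l lerN2.
Qed.

End sl_reduction.

(** * Eigenfunctions *)

Section eigenfunctions.
Context {R : realType}.
Variables (a eps : R).
Hypothesis reg : elliptic_regime a eps.
Implicit Types (s t x y c lam : R) (f h : R -> R).

Local Notation L := (ellL eps).
Local Notation Rr := (ellR a eps).
Local Notation edge := (edge a eps).
Local Notation A := (lle_A a eps).
Local Notation B := (lle_B a eps).
Local Notation P := (region_P a eps).
Local Notation W := (region_W a eps).
Local Notation wt := (region_weight a eps).

(** The power of [t + eps] by which [weight_p] differs from the solution of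
    [p' / p = B / A], with an arbitrary exponent [c] so as to cover its inverse. *)
Definition shift_power c s := expR (c * ln (s + eps)).

Lemma shift_powerN c s : shift_power (- c) s * shift_power c s = 1.
Proof. by rewrite /shift_power -expRD mulNr addNr expR0. Qed.

Lemma weight_g_edge s : L < s -> s <= eps ->
  weight_g a eps s = edge_weight a eps s * shift_power (16 * a * eps) s.
Proof.
move=> Ls se; have sL : 0 < s - L by rewrite subr_gt0.
have sc : 0 < (2 + Num.sqrt 3) * eps - s.
  by rewrite subr_gt0; exact: le_lt_trans (eps_lt_cp reg).
have s0 : 0 < s + eps by rewrite addr_gt0 ?(eps_gt0 reg)//; exact: lt_trans (ellL_gt0 reg) Ls.
rewrite /weight_g -/(ellL eps) (gtr0_norm sL) distrC (gtr0_norm sc).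
rewrite /powR !gt_eqF// -!expRD; congr expR.
by rewrite /edge_log /edge_reg; ring.
Qed.

Lemma weight_p_region t : L < t < Rr ->
  weight_p a eps t = wt t * shift_power (16 * a * eps) (edge t).
Proof.
move=> /(edge_bounds reg)/andP[Le ee].
by rewrite (weight_p_edge reg) weight_g_edge.
Qed.

Lemma shift_power_lipschitz c : exists2 C, 0 < C & forall x y,
  L <= x -> x <= y -> y <= Rr ->
  `|shift_power c (edge y) - shift_power c (edge x)| <= C * (y - x).
Proof.
have Leps := ltW (ellL_lt_eps reg); have e0 := eps_gt0 reg.
have ds s : 0 < s -> is_derive s 1 (shift_power c) (shift_power c s * (c * (s + eps)^-1)).
  move=> s0; have se : 0 < s + eps by rewrite addr_gt0.
  have da : is_derive s 1 (fun x => x + eps) 1.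
    have := is_deriveDf (is_derive_id s 1) (is_derive_cst eps s 1).
    by congr is_derive; rewrite addr0.
  have dl := @is_derive_compf R (@ln R) (fun x => x + eps) s _ _ (is_derive1_ln se) da.
  have := is_derive_compf (is_derive_expR _) (is_deriveZf c dl).
  by congr is_derive; rewrite mulr1.
have Lpos s : L <= s -> 0 < s by exact: lt_le_trans (ellL_gt0 reg).
have cs : {within `[L, eps], continuous (shift_power c)}.
  apply: continuous_in_subspaceT => s; rewrite inE /= in_itv/= => /andP[Ls se].
  exact: is_derive_continuous (ds s (Lpos s Ls)).
have [K K0 hK] := within_continuous_bounded Leps cs.
pose C := K * (`|c| / eps) + 1.
have C0 : 0 < C by rewrite ltr_wpDl// mulr_ge0 ?divr_ge0// ltW.
have lip u v : L <= u -> u <= v -> v <= eps ->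
    `|shift_power c v - shift_power c u| <= C * (v - u).
  move=> Lu uv ve; rewrite mulrBr.
  apply: (@increment_bound R L eps (shift_power c) (fun x => C * x)
    (fun s => shift_power c s * (c * (s + eps)^-1)) (fun=> C * 1)) => //.
  - apply: within_continuousMf; first exact: within_continuous_cst.
    by apply: continuous_subspaceT => x; exact: cvg_id.
  - by move=> t /andP[Lt _]; exact/ds/Lpos/ltW.
  move=> t /andP[/ltW Lt /ltW te]; rewrite mulr1 normrM.
  apply: (@le_trans _ _ (K * (`|c| / eps))); last by rewrite lerDl.
  apply: ler_pM => //; first exact: hK.
  rewrite normrM ler_wpM2l// normfV lef_pV2 ?posrE ?normr_gt0.
  - by apply: (le_trans _ (ler_norm _)); rewrite lerDr ltW// Lpos.
  - by rewrite gt_eqF// addr_gt0// Lpos.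
  - exact: e0.
exists C => // x y Lx xy yR.
have /andP[Lex exe] : L <= edge x <= eps by apply: (edge_bounds_le reg); rewrite Lx (le_trans xy).
have /andP[Ley eye] : L <= edge y <= eps by apply: (edge_bounds_le reg); rewrite (le_trans Lx).
have := edge_lipschitz a eps xy.
have [exy|/ltW eyx] := leP (edge x) (edge y).
  rewrite ger0_norm ?subr_ge0// => h; apply: (le_trans (lip _ _ Lex exy eye)).
  by rewrite ler_pM2l.
rewrite distrC ger0_norm ?subr_ge0// distrC => h; apply: (le_trans (lip _ _ Ley eyx exe)).
by rewrite ler_pM2l.
Qed.

(** Dividing [weight_p * f'] by the smooth factor gives [h = p f'], which is
    absolutely continuous. Almost everywhere its derivative is [lambda W f], a
    continuous function, so [h] is a classical solution. *)
Lemma eigenfunction_system lam f : dirichlet_eigenfunction a eps lam f ->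
  exists h, sl_dirichlet L Rr P W (- lam) f h.
Proof.
move=> [[fAC [h0 h0AC dh0]] fn0 fae [fL fR]].
have LR := ellL_ltR reg; have LR' := ltW LR.
have [C C0 hC] := shift_power_lipschitz (- (16 * a * eps)).
pose h t := shift_power (- (16 * a * eps)) (edge t) * h0 t.
have hAC : absolutely_continuous L Rr h.
  exact: absolutely_continuousM_lipschitz LR' C0 h0AC hC.
have hE t : L < t < Rr -> h t = wt t * derive1 f t.
  move=> tlr; have [_ e] := dh0 t tlr.
  rewrite /h e (weight_p_region tlr); have := shift_powerN (16 * a * eps) (edge t).
  set u := shift_power (- (16 * a * eps)) (edge t).
  set v := shift_power (16 * a * eps) (edge t) => uv.
  by rewrite [wt t * v]mulrC -mulrA mulrA uv mul1r.
have df t : L < t < Rr -> is_derive t 1 f (P t * h t).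
  move=> tlr; have [d _] := dh0 t tlr.
  rewrite hE// mulrA mulVf ?gt_eqF ?region_weight_gt0// mul1r derive1E.
  by split.
have cf := absolutely_continuous_within LR' fAC.
have ch := absolutely_continuous_within LR' hAC.
exists h; split; [split; [exact: cf|exact: ch|exact: df|]|exact: fL|exact: fR|exact: fn0].
move=> t tlr; rewrite mulNr mulNr opprK.
have cWf s : L < s < Rr -> {for s, continuous (fun s => lam * W s * f s)}.
  move=> slr; apply: continuousM; last exact: is_derive_continuous (df s slr).
  apply: continuousM; first exact: cst_continuous.
  exact: slW_continuous (region_coefficients reg) s slr.
have nN : (@lebesgue_measure R).-negligible
   (~` [set t | L <= t <= Rr -> derivable (derive1 f) t 1 /\ lle_op a eps f t = lam * f t]
    `|` [set eps] `|` [set a - eps]).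
  apply: negligibleU; [apply: negligibleU => //|];
    by apply/negligibleP => //; exact: lebesgue_measure_set1.
apply: (absolutely_continuous_derive hAC nN _ tlr (cWf t tlr)) => s slr Ns.
have [ds es] : derivable (derive1 f) s 1 /\ lle_op a eps f s = lam * f s.
  move: slr => /andP[/ltW Ls /ltW sR].
  have /contrapT : ~ ~ (L <= s <= Rr -> derivable (derive1 f) s 1 /\ lle_op a eps f s = lam * f s).
    by move=> n; apply: Ns; left; left.
  by apply; rewrite Ls.
have se : s <> eps by move=> e; apply: Ns; left; right.
have sa : s <> a - eps by move=> e; apply: Ns; right.
have dw := region_weight_derive reg slr se sa.
have dd : is_derive s 1 (derive1 f) (derive1 (derive1 f) s) by rewrite derive1E; split.
apply: (@near_eq_is_derive _ _ _ (fun s => wt s * derive1 f s)).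
  by near=> x; apply/esym/hE; near: x; exact: near_oo.
have := is_deriveMf dw dd; congr is_derive.
have A0 : A s != 0 by rewrite gt_eqF// (lle_A_gt0 reg).
rewrite /= [RHS]mulrAC -es /lle_op /region_W; field; exact: A0.
Unshelve. all: by end_near. Qed.

(** A classical solution is absolutely continuous since its increments are
    dominated by those of [sl_measure]. The equation is checked away from the end
    points and from the two points where the coefficients are glued. *)
Lemma system_eigenfunction lam f h : sl_dirichlet L Rr P W (- lam) f h ->
  dirichlet_eigenfunction a eps lam f.
Proof.
move=> [[cf ch df dh] fL fR fn0].
have LR := ellL_ltR reg; have LR' := ltW LR.
have slH := region_coefficients reg.
have sAC := sl_measure_absolutely_continuous slH.
have bounded_AC (u du v : R -> R) M : 0 < M -> {within `[L, Rr], continuous u} ->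
    (forall t, L < t < Rr -> is_derive t 1 u (du t)) ->
    (forall t, L < t < Rr -> `|du t| <= M * (P t + W t)) ->
    absolutely_continuous L Rr u.
  move=> M0 cu du' bu; apply: (absolutely_continuous_dominated M0 sAC) => x y Lx xy yR.
  rewrite [X in M * X]ger0_norm; last first.
    by rewrite subr_ge0; apply: (sl_measure_nondecreasing slH).
  rewrite mulrBr.
  apply: (@increment_bound R L Rr u (fun t => M * sl_measure L P W t) du
    (fun t => M * (P t + W t))) => //.
  - apply: within_continuousMf (sl_measure_continuous slH); exact: within_continuous_cst.
  - by move=> t tlr; apply: is_deriveZf; exact: (sl_measure_derive slH).
have [Mf Mf0 hMf] := within_continuous_bounded LR' cf.
have [Mh Mh0 hMh] := within_continuous_bounded LR' ch.
have fAC : absolutely_continuous L Rr f.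
  apply: (bounded_AC f _ f Mh) df _ => // t tlr.
  have p0 := slP_gt0 slH tlr; have w0 := slW_gt0 slH tlr.
  rewrite normrM (gtr0_norm p0) mulrC ler_pM// ?(ltW p0)//; last by rewrite lerDl ltW.
  by apply: hMh; move: tlr => /andP[/ltW + /ltW].
have hAC : absolutely_continuous L Rr h.
  have M0 : 0 < `|lam| * Mf + 1 by rewrite ltr_wpDl// mulr_ge0// ltW.
  apply: (bounded_AC h _ h _ M0 ch dh) => t tlr.
  have p0 := slP_gt0 slH tlr; have w0 := slW_gt0 slH tlr.
  have ft : `|f t| <= Mf by apply: hMf; move: tlr => /andP[/ltW + /ltW].
  rewrite !mulNr opprK normrM normrM (gtr0_norm w0) mulrAC.
  apply: ler_pM; [by rewrite mulr_ge0|exact: ltW| |by rewrite lerDr ltW].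
  by apply: (@le_trans _ _ (`|lam| * Mf)); [rewrite ler_wpM2l|rewrite lerDl].
have [C C0 hC] := shift_power_lipschitz (16 * a * eps).
have f'E t : L < t < Rr -> derive1 f t = P t * h t.
  by move=> /df[_ e]; rewrite derive1E.
split => //.
- split => //.
  exists (fun t => shift_power (16 * a * eps) (edge t) * h t).
    exact: absolutely_continuousM_lipschitz LR' C0 hAC hC.
  move=> t tlr; split; first by case: (df t tlr).
  rewrite f'E// (weight_p_region tlr) /region_P.
  have := region_weight_gt0 a eps t; move: (wt t) => w w0.
  by field; rewrite gt_eqF.
- have nN : (@lebesgue_measure R).-negligible
      ([set L] `|` [set Rr] `|` [set eps] `|` [set a - eps]).
    by do 3?[apply: negligibleU]; apply/negligibleP => //; exact: lebesgue_measure_set1.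
  apply: negligibleS nN => t /= /not_implyP[/andP[Lt tR] nt].
  apply: contrapT => Nt; apply: nt.
  have tL : t <> L by move=> e; apply: Nt; left; left; left.
  have tRr : t <> Rr by move=> e; apply: Nt; left; left; right.
  have te : t <> eps by move=> e; apply: Nt; left; right.
  have ta : t <> a - eps by move=> e; apply: Nt; right.
  have tlr : L < t < Rr.
    by rewrite !lt_neqAle Lt tR !andbT; apply/andP; split; apply/eqP => // /esym.
  have w0 := region_weight_gt0 a eps t.
  have wn0 : wt t != 0 by rewrite gt_eqF.
  have A0 : A t != 0 by rewrite gt_eqF// (lle_A_gt0 reg).
  have dP := is_deriveV wn0 (region_weight_derive reg tlr te ta).
  have df' : is_derive t 1 (derive1 f)
      ((- wt t ^- 2 *: (wt t * (B t / A t))) * h t + P t * - (- lam * W t * f t)).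
    apply: (@near_eq_is_derive _ _ _ (fun s => P s * h s)).
      by near=> s; apply/esym/f'E; near: s; exact: near_oo.
    exact: is_deriveMf dP (dh t tlr).
  split; first by case: df'.
  rewrite /lle_op; have -> : derive1 (derive1 f) t =
      (- wt t ^- 2 *: (wt t * (B t / A t))) * h t + P t * - (- lam * W t * f t).
    by rewrite [LHS]derive1E; case: df' => _ ->.
  rewrite (f'E t tlr) /GRing.scale /= /region_P /region_W.
  by field; rewrite wn0 A0.
Unshelve. all: by end_near. Qed.

End eigenfunctions.

Lemma elliptic_regime_small (R : realType) (a : R) : 0 < a ->
  exists2 eps0 : R, 0 < eps0 & forall eps, 0 < eps -> eps < eps0 ->
    elliptic_regime a eps.
Proof.
move=> a0; pose b := (4 + 2 * Num.sqrt 3) * a.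
have b0 : 0 < b by rewrite mulr_gt0//; have := @sqrt3_gt1 R; lra.
exists (Num.min 1 (Num.min (a / 2) (1 / 2 / b))).
  by rewrite !lt_min ltr01 !divr_gt0.
move=> eps e0; rewrite !lt_min => /andP[e1 /andP[ea eb]]; split => //.
  by move: ea; lra.
by rewrite -/b mulrC -ltr_pdivlMr.
Qed.

Unset Implicit Arguments.

Theorem corollary5p2 (R : realType) (a : R) (a_gt0 : 0 < a) :
  exists2 eps0 : R, 0 < eps0 &
  forall eps : R, 0 < eps -> eps < eps0 ->
  exists lambda : nat -> R,
    [/\ forall x : R, dirichlet_eigenvalue a eps x <-> exists n, x = lambda n,
        forall m n : nat, (m < n)%N -> lambda n < lambda m,
        lambda n @[n --> \oo] --> -oo,
        (* the eigenfunction of lambda n is unique up to a scalar *)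
        forall (n : nat) (f g : R -> R),
          dirichlet_eigenfunction a eps (lambda n) f ->
          dirichlet_eigenfunction a eps (lambda n) g ->
          exists c : R, forall t, ellL eps <= t <= ellR a eps ->
            g t = c * f t
      & forall (n : nat) (f : R -> R),
          dirichlet_eigenfunction a eps (lambda n) f ->
          ([set t | ellL eps < t < ellR a eps /\ f t = 0] #= `I_n)%card].
Proof.
have [eps0 eps00 regime] := elliptic_regime_small a_gt0.
exists eps0 => // eps e0 ee; have reg := regime eps e0 ee.
have [kappa [kappa0 kinc [c c0 kc] eig sys]] := sl_oscillation (region_coefficients reg).
have multiple n f : dirichlet_eigenfunction a eps (- kappa n ^+ 2) f ->
    exists u, [/\ ([set t | ellL eps < t < ellR a eps /\ u t = 0] #= `I_n)%card,
      (forall g, dirichlet_eigenfunction a eps (- kappa n ^+ 2) g ->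
        exists d, forall t, ellL eps <= t <= ellR a eps -> g t = d * u t) &
      exists2 d, d != 0 & forall t, ellL eps <= t <= ellR a eps -> f t = d * u t].
  move=> fE; have [u [v [_ uprop ucard]]] := sys n.
  have prop g : dirichlet_eigenfunction a eps (- kappa n ^+ 2) g ->
      exists d, forall t, ellL eps <= t <= ellR a eps -> g t = d * u t.
    move=> /(eigenfunction_system reg)[h]; rewrite opprK => /uprop[d gd].
    by exists d => t /andP[lt tr]; exact: gd.
  exists u; split => //; have [d fd] := prop f fE.
  exists d => //; have [_ [t tlr ft] _ _] := fE.
  by apply: contra_neq ft => d0; rewrite fd// d0 mul0r.
exists (fun n => - kappa n ^+ 2); split.
- move=> x; split => [[f /(eigenfunction_system reg)[h /eig[n xn]]]|[n ->]].
    by exists n; rewrite -xn opprK.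
  have [u [v [uD _ _]]] := sys n; exists u.
  by apply: (@system_eigenfunction _ _ _ reg _ u v); rewrite opprK.
- move=> m n mn; rewrite ltrN2 ltr_pXn2r ?nnegrE ?(ltW (kappa0 _))//.
  exact: kinc.
- apply/cvgrNyPle => M.
  have [N _ hN] := nbhs_infty_ger (- M / c ^+ 2).
  exists N => // n /hN /= nM; rewrite lerNl.
  have c2 : 0 < c ^+ 2 by rewrite exprn_gt0.
  apply: (@le_trans _ _ (n%:R * c ^+ 2)); first by rewrite -ler_pdivrMr.
  (* [kappa n >= (n + 1) c] makes [kappa n ^ 2] grow at least linearly *)
  apply: (@le_trans _ _ ((n.+1%:R * c) ^+ 2)); last first.
    by rewrite ler_pXn2r ?nnegrE ?mulr_ge0 ?(ltW c0) ?(ltW (kappa0 _)).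
  rewrite exprMn ler_pM2r// -natrX ler_nat.
  by rewrite (leq_trans (leqnSn n))// leq_pmulr.
- move=> n f g fE gE; have [u [_ uprop [d d0 fd]]] := multiple n f fE.
  have [d' gd'] := uprop g gE; exists (d' / d) => t tlr.
  by rewrite gd'// fd// mulrA divfK.
- move=> n f /multiple[u [ucard _ [d d0 fd]]].
  suff -> : [set t | ellL eps < t < ellR a eps /\ f t = 0] =
      [set t | ellL eps < t < ellR a eps /\ u t = 0] by [].
  apply/seteqP; split => t /= [tlr ft]; split => //.
    move: ft; rewrite fd; last by move: tlr => /andP[/ltW -> /ltW].
    by move/eqP; rewrite mulf_eq0 (negPf d0) => /eqP.
  by rewrite fd ?ft ?mulr0//; move: tlr => /andP[/ltW -> /ltW].
Qed.
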